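(* Let $X=\prod_i X_i$ be a finite product of connected manifolds with corners $X_i$ with $\operatorname{codim}(X_i)\le 2$ for all $i$. Then the groups $H_*^{\mathrm{pcn}}(X)$ are torsion free.
   Context: Manifold with corners: a Hausdorff space $X$ contained in a smooth manifold $\tilde X$ of the same dimension, with finitely many connected boundary hyperfaces $H_1,\dots,H_N$ and defining functions $r_1,\dots,r_N\in C^\infty(\tilde X)$, such that $X=\bigcap_j\{r_j\ge 0\}$, $H_j=X\cap\{r_j=0\}$, and for every subset $J$ of indices the $dr_j$, $j\in J$, are linearly independent at every point of $\bigcap_{j\in J}\{r_j=0\}$. An open face of codimension $p$ is a connected component of the set of points of $X$ at which exactly $p$ of the $r_j$ vanish; $F_p$ is the set of these faces. The codimension of $X$ is the largest $p$ with $F_p\neq\emptyset$. On a product, the defining functions are the pull-backs of those of the factors. Conormal homology: put $e_j=dr_j$. If $f\in F_p$ lies in $H_I=H_{i_1}\cap\dots\cap H_{i_p}$, $I=(i_1<\dots<i_p)$, the conormal bundle $N(f)$ has the global basis $(e_i)_{i\in I}$ and its orientations are $\pm e_I$, $e_I=e_{i_1}\wedge\dots\wedge e_{i_p}$. $C_p(X)$ is the free $\mathbb Z$-module generated by the symbols $f\otimes\varepsilon$, $f\in F_p$, $\varepsilon$ an orientation of $N(f)$, with $f\otimes(-\varepsilon)=-(f\otimes\varepsilon)$. Contraction: $e_i\lrcorner e_I=0$ if $i\notin I$, and $e_i\lrcorner e_I=(-1)^{j-1}e_{I\setminus\{i\}}$ if $i$ is the $j$-th coordinate of $I$. The differential $\delta_p:C_p(X)\to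 C_{p-1}(X)$ is $\delta_p(f\otimes\varepsilon)=\sum_{g\in F_{p-1},\,f\subset\overline g}g\otimes e_{i_{(g,f)}}\lrcorner\varepsilon$, where $i_{(g,f)}$ is the index of the defining function whose vanishing defines $f$ in $\overline g$. $H^{\mathrm{cn}}_p(X)=H_p(C_*(X),\delta_* )$, $H_0^{\mathrm{pcn}}(X)=\bigoplus_{p\ge0}H^{\mathrm{cn}}_{2p}(X)$, $H_1^{\mathrm{pcn}}(X)=\bigoplus_{p\ge0}H^{\mathrm{cn}}_{2p+1}(X)$. *)

(* Defs.v *)
From HB Require Import structures.
From mathcomp Require Import all_boot all_order all_algebra.
From mathcomp Require Import generic_quotient ring_quotient.
From mathcomp Require Import boolp classical_sets functions cardinality fsbigop.
From mathcomp Require Import reals topology normedtype derive.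
From mathcomp.multinomials Require Import freeg.

Set Implicit Arguments.
Unset Strict Implicit.
Unset Printing Implicit Defensive.

Import Order.TTheory GRing.Theory Num.Theory.
Import numFieldNormedType.Exports.

Local Open Scope classical_set_scope.
Local Open Scope ring_scope.

Definition torsion_free (A : zmodType) : Prop :=
  forall (x : A) (m : nat), (0 < m)%N -> x *+ m = 0 -> x = 0.

(** Homology [ker d / im d'] of [C2 --d'--> C1 --d--> C0]. *)
Section Homology.
Variables (C2 C1 C0 : zmodType).
Variables (d' : {additive C2 -> C1}) (d : {additive C1 -> C0}).

Definition cycle : {pred C1} := fun z => d z == 0.

Lemma cycle_zmod_closed : zmod_closed cycle.
Proof.
split=> [|x y]; rewrite /cycle !unfold_in ?raddf0 // => /eqP x0 /eqP y0.
by rewrite raddfB x0 y0 subrr.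
Qed.
HB.instance Definition _ := GRing.isZmodClosed.Build C1 cycle cycle_zmod_closed.

Record cycles := Cycle { cycle_val :> C1; _ : cycle_val \in cycle }.
HB.instance Definition _ := [isSub for cycle_val].
HB.instance Definition _ := [Choice of cycles by <:].
HB.instance Definition _ := [SubChoice_isSubZmodule of cycles by <:].

Definition bdry : {pred cycles} := fun z => `[< exists c, d' c = \val z >].

Lemma bdry_zmod_closed : zmod_closed bdry.
Proof.
split=> [|x y]; first by apply/asboolP; exists 0; rewrite !raddf0.
move=> /asboolP[a ax] /asboolP[b bx]; apply/asboolP.
by exists (a - b); rewrite !raddfB ax bx.
Qed.
HB.instance Definition _ :=
  GRing.isZmodClosed.Build cycles bdry bdry_zmod_closed.

Definition homology : zmodType := Quotient.quot bdry.
End Homology.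

Section DirectSum.
Variable M : nat -> zmodType.

Record dsum := DSum {
  dsum_fun :> forall p, M p;
  dsum_fin : finite_set [set p | dsum_fun p != 0] }.

Lemma dsum_eqP (s t : dsum) : (forall p, s p = t p) -> s = t.
Proof.
case: s t => [s hs] [t ht] /= st.
have {}st : s = t by exact: functional_extensionality_dep.
by case: _ / st ht => ht; congr DSum; exact: Prop_irrelevance.
Qed.

HB.instance Definition _ := gen_eqMixin dsum.
HB.instance Definition _ := gen_choiceMixin dsum.

Lemma dsum0_fin : finite_set [set p | (0 : M p) != 0].
Proof. by apply: (sub_finite_set _ (finite_set0 nat)) => p /=; rewrite eqxx. Qed.
Definition dsum0 := DSum dsum0_fin.

Lemma dsumN_fin (s : dsum) : finite_set [set p | - s p != 0].
Proof.
by apply: (sub_finite_set _ (dsum_fin s)) => p /=; rewrite oppr_eq0.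
Qed.
Definition dsumN s := DSum (dsumN_fin s).

Lemma dsumD_fin (s t : dsum) : finite_set [set p | s p + t p != 0].
Proof.
have : finite_set ([set p | s p != 0] `|` [set p | t p != 0]).
  by rewrite finite_setU; split; exact: dsum_fin.
apply: sub_finite_set => p /= st0.
have [s0|] := eqVneq (s p) 0; last by left.
by right; move: st0; rewrite s0 add0r.
Qed.
Definition dsumD s t := DSum (dsumD_fin s t).

Lemma dsumA : associative dsumD.
Proof. by move=> s t u; apply: dsum_eqP => p /=; rewrite addrA. Qed.
Lemma dsumC : commutative dsumD.
Proof. by move=> s t; apply: dsum_eqP => p /=; rewrite addrC. Qed.
Lemma dsum0D : left_id dsum0 dsumD.
Proof. by move=> s; apply: dsum_eqP => p /=; rewrite add0r. Qed.
Lemma dsumND : left_inverse dsum0 dsumN dsumD.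
Proof. by move=> s; apply: dsum_eqP => p /=; rewrite addNr. Qed.
HB.instance Definition _ :=
  GRing.isZmodule.Build dsum dsumA dsumC dsum0D dsumND.
End DirectSum.

Section Smooth.
Variable R : realType.

(** [U] is meant to be open, so that these derivatives only depend on the values
    of [f] on [U]. *)
Fixpoint Ck_on n (k : nat) (U : set 'rV[R]_n) (f : 'rV[R]_n -> R) : Prop :=
  (forall x, U x -> {for x, continuous f}) /\
  if k is k'.+1 then
    forall i : 'I_n,
      (forall x, U x -> derivable f x (delta_mx 0 i)) /\
      Ck_on k' U ('D_(delta_mx 0 i) f)
  else True.

Definition smooth_on n (U : set 'rV[R]_n) (f : 'rV[R]_n -> R) : Prop :=
  forall k, Ck_on k U f.

(** Only the values of [chart_map] on [chart_dom], and those of [chart_inv] on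
    its image, are meaningful. *)
Record chart (T : topologicalType) (n : nat) := Chart {
  chart_dom : set T;
  chart_map : T -> 'rV[R]_n;
  chart_inv : 'rV[R]_n -> T;
  chart_dom_open : open chart_dom;
  chart_img_open : open (chart_map @` chart_dom);
  chart_mapK : forall x, chart_dom x -> chart_inv (chart_map x) = x;
  chart_map_cont : {within chart_dom, continuous chart_map};
  chart_inv_cont : {within chart_map @` chart_dom, continuous chart_inv} }.

Record smooth_structure (T : topologicalType) (n : nat) := SmoothStructure {
  atlas : set (chart T n);
  atlas_cover : forall x, exists2 c, atlas c & chart_dom c x;
  atlas_compat : forall c c', atlas c -> atlas c' -> forall i : 'I_n,
    smooth_on (chart_map c @` (chart_dom c `&` chart_dom c'))
              (fun v => chart_map c' (chart_inv c v) 0 i) }.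

Definition smooth_fun T n (S : smooth_structure T n) (f : T -> R) : Prop :=
  forall c, atlas S c ->
    smooth_on (chart_map c @` chart_dom c) (f \o chart_inv c).

(** The coordinates of [df] at [x] in the basis of the cotangent space given by
    the chart [c]. *)
Definition dcoord T n (c : chart T n) (f : T -> R) (x : T) : 'rV[R]_n :=
  \row_i 'D_(delta_mx 0 i) (f \o chart_inv c) (chart_map c x).

End Smooth.

(** The faces and the conormal complex of a manifold with corners only depend on
    the topology of the ambient manifold and on the defining functions, which is
    what this structure records. *)
Record cornered_space (R : realType) := CorneredSpace {
  ambient : topologicalType;
  nhyp : nat;
  defun : 'I_nhyp -> ambient -> R }.

Section CorneredSpace.
Variables (R : realType) (X : cornered_space R).

Definition carrier : set (ambient X) := [set x | forall j, 0 <= @defun R X j x].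

Definition hyperface (j : 'I_(nhyp X)) : set (ambient X) :=
  carrier `&` [set x | defun j x = 0].

Definition stratum (p : nat) : set (ambient X) :=
  [set x | carrier x /\ #|[set j | defun j x == 0]%SET| = p].

Definition faces (p : nat) : set (set (ambient X)) :=
  [set connected_component (stratum p) x | x in stratum p].

Definition codim : nat :=
  \max_(p < (nhyp X).+1 | `[< faces p !=set0 >]) p.

(** The set [I] of indices such that [f] lies in [H_I]. *)
Definition face_idx (f : set (ambient X)) : {set 'I_(nhyp X)} :=
  [set i | `[< f `<=` hyperface i >]]%SET.

(** [e_i] contracted with [e_I] is [contr_coef i I] times [e_(I \ i)]. *)
Definition contr_coef (i : 'I_(nhyp X)) (I : {set 'I_(nhyp X)}) : int :=
  if i \in I then (-1) ^+ #|[set k in I | (k < i)%N]%SET| else 0.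

(** Since [f (x) (- e) = - (f (x) e)], the symbols [f (x) e_I] with [f] in [F_p]
    and [I = face_idx f] form a basis of [C_p(X)]: the element [<< f >>] stands
    for [f (x) e_I], and [- << f >>] for [f (x) (- e_I)]. *)
Definition chain (p : nat) := {freeg (faces p) / int}.

(** The contraction coefficient of [e_i] with [e_(face_idx f)], where [i] is the
    index of the function whose vanishing defines [f] in the closure of [g]; if
    [f] and [g] are faces of a manifold with corners, of respective codimensions
    [p] and [p - 1], with [f] included in the closure of [g], then [i] is the
    only element of [face_idx f :\: face_idx g] and removing it from [face_idx f]
    leaves [face_idx g]. *)
Definition incidence (g f : set (ambient X)) : int :=
  if [pick i in face_idx f :\: face_idx g] is Some i
  then contr_coef i (face_idx f) else 0.

Definition delta_gen (p : nat) (f : faces p) : chain p.-1 :=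
  if p is 0 then 0 else
  \sum_(g \in [set g : faces p.-1 | val f `<=` closure (val g)])
    << incidence (val g) (val f) *g g >>.

(** For [p = 0] the codomain is [chain X 0.-1 = chain X 0] instead of
    [C_(-1) = 0], but the map is zero. *)
Definition delta (p : nat) : chain p -> chain p.-1 := fglift (@delta_gen p).

HB.instance Definition _ p := GRing.isZmodMorphism.Build (chain p) (chain p.-1)
  (@delta p) (@lift_is_additive _ _ _ (@delta_gen p)).

Definition Hcn (p : nat) : zmodType := homology (@delta p.+1) (@delta p).

Definition H0pcn : zmodType := dsum (fun p => Hcn p.*2).
Definition H1pcn : zmodType := dsum (fun p => Hcn p.*2.+1).

End CorneredSpace.

Arguments carrier {R} X.
Arguments hyperface {R} X j.
Arguments stratum {R} X p.
Arguments faces {R} X p.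
Arguments codim {R} X.
Arguments chain {R} X p.
Arguments delta {R} X p.
Arguments Hcn {R} X p.
Arguments H0pcn {R} X.
Arguments H1pcn {R} X.

Record manifold_with_corners (R : realType) := ManifoldWithCorners {
  mwc_space :> cornered_space R;
  mwc_hausdorff : hausdorff_space (ambient mwc_space);
  mwc_second_countable : @second_countable (ambient mwc_space);
  mwc_dim : nat;
  mwc_smooth : smooth_structure R (ambient mwc_space) mwc_dim;
  mwc_defun_smooth : forall j, smooth_fun mwc_smooth (@defun R mwc_space j);
  mwc_hyperface_nonempty : forall j, hyperface mwc_space j !=set0;
  mwc_hyperface_connected : forall j, connected (hyperface mwc_space j);
  mwc_independent : forall (J : {set 'I_(nhyp mwc_space)}) x,
    (forall j, j \in J -> defun j x = 0) ->
    forall c, atlas mwc_smooth c -> chart_dom c x ->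
      free [seq dcoord c (@defun R mwc_space j) x | j <- enum J] }.

(** The defining functions of a product are the pull-backs of those of the
    factors, listed factor by factor ([tagnat] is the lexicographic bijection
    between ['I_(\sum_i N i)] and [{i & 'I_(N i)}]). *)
Definition corner_prod (R : realType) (n : nat)
    (X : 'I_n -> cornered_space R) : cornered_space R :=
  @CorneredSpace R (prod_topology (fun i => ambient (X i)))
    (\sum_i nhyp (X i))%N
    (fun k x => defun (tagnat.sig2 k) (x (tagnat.sig1 k))).

(* Main.v *)
(** Write [d_i] for the differential of the conormal complex of the factor [X_i].
    If [d_i] admits a generalized inverse [h_i], [d_i h_i d_i = d_i], then
    [1 - d_i h_i - h_i d_i] is homotopic to the identity and is annihilated by
    [d_i], so the differential of a tensor product of such complexes again has a
    generalized inverse; its image is then a pure subgroup, and the homology is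
    torsion free.

    A generalized inverse exists as soon as the differential of each generator is
    a difference of two elements that are generators or zero. In codimension at
    most two this holds for conormal complexes: a face [f] contained in [H_I] is
    in the closure of exactly one face of index set [J], for each [J] included in
    [I], so that the differential of a face of codimension two is a difference of
    two faces. This uniqueness follows from the local shape of the strata, which
    are straightened to linear ones by the inverse function theorem. For the same
    reason the conormal complex of the product is the tensor product of those of
    the factors, the faces of the product being the products of faces. *)

From HB Require Import structures.
From mathcomp Require Import all_boot all_order all_algebra ssrAC.
From mathcomp Require Import generic_quotient ring_quotient.
From mathcomp Require Import boolp classical_sets functions fsbigop.
From mathcomp Require Import reals interval_inference topology.
From mathcomp Require Import normedtype sequences derive.
From mathcomp Require Import ring lra.
From mathcomp.multinomials Require Import freeg.
Require Import Defs.

Set Implicit Arguments.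
Unset Strict Implicit.
Unset Printing Implicit Defensive.

Import Order.TTheory GRing.Theory Num.Theory.
Import numFieldNormedType.Exports.

Local Open Scope classical_set_scope.
Local Open Scope ring_scope.

(** * Generalized inverses of sums of anticommuting differentials *)

Section SumOfDifferentials.
Variables (V : zmodType) (d h : nat -> {additive V -> V}).

Fixpoint sum_diff (k : nat) : {additive V -> V} :=
  if k is k'.+1 then sum_diff k' \+ d k' else \0.

Lemma sum_diffE k x : sum_diff k x = \sum_(i < k) d i x.
Proof. by elim: k => [|k IHk]; rewrite ?big_ord0 // big_ord_recr /= -IHk. Qed.

Variable n : nat.
Hypothesis dd0 : forall i x, (i < n)%N -> d i (d i x) = 0.
Hypothesis ddN : forall i j x, (i < j < n)%N -> d j (d i x) = - d i (d j x).
Hypothesis dhN : forall i j x, (i < j < n)%N -> d j (h i x) = - h i (d j x).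
Hypothesis hdN : forall i j x, (i < j < n)%N -> h j (d i x) = - d i (h j x).
Hypothesis dhd : forall i x, (i < n)%N -> d i (h i (d i x)) = d i x.

Lemma diff_sum_diff k j x : (k <= j < n)%N ->
  d j (sum_diff k x) = - sum_diff k (d j x).
Proof.
move=> /andP[kj jn]; rewrite !sum_diffE raddf_sum -sumrN; apply: eq_bigr => i _.
by apply: ddN; rewrite jn (leq_trans (ltn_ord i)).
Qed.

Lemma sum_diff_sum_diff k x : (k <= n)%N -> sum_diff k (sum_diff k x) = 0.
Proof.
elim: k => [//|k IHk] in x * => kn; rewrite /= /GRing.add_fun.
rewrite (raddfD (sum_diff k)) (raddfD (d k)) /= IHk ?(ltnW kn) // dd0 //.
by rewrite diff_sum_diff ?leqnn // add0r addr0 subrr.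
Qed.

(* With [p_i := 1 - d_i h_i - h_i d_i], the sum [H] of the [p_0 ... p_(i-1) h_i]
   is a homotopy between the identity and [P := p_0 ... p_(k-1)], and [P] kills
   boundaries; the induction also carries the commutation of [H] and [P] with
   the differentials still to be added. *)
Lemma sum_diff_homotopy k : (k <= n)%N ->
  exists P H : {additive V -> V},
    [/\ forall x, sum_diff k (H x) + H (sum_diff k x) = x - P x,
        forall x, sum_diff k (P x) = 0, forall x, P (sum_diff k x) = 0,
        forall j x, (k <= j < n)%N -> d j (H x) = - H (d j x) &
        forall j x, (k <= j < n)%N -> d j (P x) = P (d j x)].
Proof.
elim: k => [_|k IHk kn].
  exists (@idfun V), \0; split=> [x|x|x|j x _|j x _] //=; rewrite ?addr0 ?subrr //.
    by rewrite /GRing.null_fun raddf0 oppr0.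
have [P [H [DH DP PD dH dP]]] := IHk (ltnW kn).
have Dh x : h k (sum_diff k x) = - sum_diff k (h k x).
  rewrite !sum_diffE raddf_sum -sumrN; apply: eq_bigr => i _.
  by apply: hdN; rewrite kn ltn_ord.
have kk : (k <= k < n)%N by rewrite leqnn.
(* With [D] for [sum_diff k], expand [(D + d k)(H + P h k) + (H + P h k)(D + d k)]: the terms
   [d k H] and [H d k] cancel, those reducing to [D P] or [P D] vanish, and
   [1 - P + P (d k h k + h k d k)] is left. *)
exists (P \o (@idfun V \- ((d k \o h k) \+ (h k \o d k)))), (H \+ (P \o h k)).
split=> [x|x|x|j x|j x] /=; rewrite /GRing.add_fun /GRing.sub_fun /=.
- rewrite !raddfD /= DP dH // dP // Dh !raddfN /= PD !raddfN /= oppr0 addr0 add0r.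
  rewrite !opprK [RHS]addrA -DH !addrA; rewrite [LHS](ACl (1*4*(5*2)*3*6)) /=.
  by rewrite subrr addr0.
- rewrite DP add0r dP // !raddfB /= !raddfD /= dd0 // dhd // raddf0.
  by rewrite oppr0 add0r subrr.
(* The new factor [1 - d k h k - h k d k] commutes with [sum_diff k], whose image [P] kills, and
   vanishes on the image of [d k]. *)
- rewrite (raddfD (d k)) /= dd0 // addr0 diff_sum_diff // (raddfD (h k)) /= Dh !raddfN /=.
  rewrite (raddfD (d k)) raddfN /= diff_sum_diff // Dh opprK dhd // !opprK.
  by rewrite !raddfB /= !raddfD /= !PD add0r subr0 oppr0 add0r subrr.
- move=> /andP[kj jn]; have kjn : (k <= j < n)%N by rewrite ltnW.
  by rewrite raddfD /= dH // dP // dhN ?kj // raddfN opprD.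
- move=> /andP[kj jn]; have kjn : (k <= j < n)%N by rewrite ltnW.
  rewrite dP // (raddfB (d j)) (raddfD (d j)) /= (ddN (h k x) (i := k) (j := j)) ?kj //.
  rewrite (dhN x) ?kj // (dhN (d k x)) ?kj // (ddN x (i := k) (j := j)) ?kj //.
  by rewrite (raddfN (d k)) (raddfN (h k)) !opprK.
Qed.

(** Evaluate the homotopy on a boundary: the term with two differentials and the term with [P]
    vanish, so [H] itself is a generalized inverse. *)
Lemma sum_diff_regular :
  exists H : {additive V -> V}, forall x, sum_diff n (H (sum_diff n x)) = sum_diff n x.
Proof.
have [P [H [DH DP PD _ _]]] := sum_diff_homotopy (leqnn n).
exists H => x.
by have := DH (sum_diff n x); rewrite sum_diff_sum_diff // raddf0 addr0 PD subr0.
Qed.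
End SumOfDifferentials.

Lemma sum_ord_regular (V : zmodType) (n : nat) (d h : 'I_n -> {additive V -> V}) :
    (forall i x, d i (d i x) = 0) ->
    (forall (i j : 'I_n) x, (i < j)%N -> d j (d i x) = - d i (d j x)) ->
    (forall (i j : 'I_n) x, (i < j)%N -> d j (h i x) = - h i (d j x)) ->
    (forall (i j : 'I_n) x, (i < j)%N -> h j (d i x) = - d i (h j x)) ->
    (forall i x, d i (h i (d i x)) = d i x) ->
  exists H : {additive V -> V},
    forall x, \sum_i d i (H (\sum_i d i x)) = \sum_i d i x.
Proof.
(* [inord] needs an inhabited ordinal type, so the empty sum is treated apart. *)
case: n d h => [|n] d h dd0 ddN dhN hdN dhd.
  by exists \0 => x; rewrite !big_ord0.
have D x : \sum_i d i x = sum_diff (fun i => d (inord i)) n.+1 x.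
  by rewrite sum_diffE; apply: eq_bigr => i _; rewrite inord_val.
have ij i j : (i < j < n.+1)%N -> ((inord i : 'I_n.+1) < (inord j : 'I_n.+1))%N.
  by move=> /andP[ij jn]; rewrite !inordK // (ltn_trans ij).
have [|||||H HP] := @sum_diff_regular V (fun i => d (inord i)) (fun i => h (inord i))
    n.+1.
- by move=> i x _; apply: dd0.
- by move=> i j x /ij; apply: ddN.
- by move=> i j x /ij; apply: dhN.
- by move=> i j x /ij; apply: hdN.
- by move=> i x _; apply: dhd.
by exists H => x; rewrite !D HP.
Qed.

(** * Tensor products of complexes with bases *)

HB.instance Definition _ (R : nzRingType) (K : choiceType) (M : lmodType R)
    (f : K -> M) :=
  GRing.isZmodMorphism.Build {freeg K / R} M (fglift f) (lift_is_additive f).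

Lemma freegUE (K : choiceType) (c : int) (k : K) : << c *g k >> = << k >> *~ c.
Proof. by rewrite freegU_mulz intz. Qed.

Lemma int_scalerE (M : lmodType int) (c : int) (x : M) : c *: x = x *~ c.
Proof. by rewrite -[c in LHS]intz scaler_int. Qed.

Lemma fgliftE (R : nzRingType) (K : choiceType) (M : lmodType R) (f : K -> M)
    (c : {freeg K / R}) :
  fglift f c = \sum_(k <- dom c) coeff k c *: f k.
Proof.
by rewrite -[c in LHS]freeg_sumE raddf_sum; apply: eq_bigr => k _; rewrite /= liftU.
Qed.

Lemma fgliftU (R : nzRingType) (K : choiceType) (M : lmodType R) (f : K -> M) (k : K) :
  fglift f << k >> = f k.
Proof. by rewrite liftU scale1r. Qed.

Lemma freeg_ext (K : choiceType) (V : zmodType) (f g : {additive {freeg K / int} -> V}) :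
  (forall k, f << k >> = g << k >>) -> f =1 g.
Proof.
move=> fg c; rewrite -[c]freeg_sumE !raddf_sum; apply: eq_bigr => k _ /=.
by rewrite freegUE !raddfMz /= fg.
Qed.

Section CoordinateOperators.
Variables (n : nat) (K : 'I_n -> choiceType) (wt : forall i, K i -> nat).
Let T := forall i, K i.
Let V := {freeg T / int}.

(** The free group [V] on tuples is the tensor product of the free groups on the [K i]; a chain is
    inserted here as the [i]-th factor among the generators [t j]. *)
Definition subst_coord (t : T) (i : 'I_n) : {freeg (K i) / int} -> V :=
  fglift (fun k => << dfwith t k >>).

Arguments subst_coord : clear implicits.
HB.instance Definition _ t i := GRing.isZmodMorphism.Build
  {freeg (K i) / int} V (subst_coord t i) (lift_is_additive _).

Definition coord_sign (t : T) (i : 'I_n) : int :=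
  (-1) ^+ \sum_(j < n | (j < i)%N) wt (t j).

(* The Koszul sign makes operators of odd degree on distinct coordinates
   anticommute. *)
Definition coord_op (i : 'I_n) (A : {freeg (K i) / int} -> {freeg (K i) / int}) :
    V -> V :=
  fglift (fun t => coord_sign t i *: subst_coord t i (A << t i >>)).

Arguments coord_op : clear implicits.
HB.instance Definition _ i A := GRing.isZmodMorphism.Build
  V V (coord_op i A) (lift_is_additive _).

(** Tracking parity alone treats alike the differentials, which lower the degree, and their
    generalized inverses. *)
Definition odd_op (i : 'I_n) (A : {freeg (K i) / int} -> {freeg (K i) / int}) :=
  forall k k', k' \in dom (A << k >>) -> odd (wt k') = ~~ odd (wt k).

Lemma dfwith_twice (t : T) i (k k' : K i) : dfwith (dfwith t k) k' = dfwith t k'.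
Proof.
apply: functional_extensionality_dep => j.
by case: (dfwithP t k' j) => [|j' ij]; rewrite ?dfwith_in ?dfwith_out.
Qed.

Lemma dfwithC (t : T) (i j : 'I_n) (k : K i) (l : K j) : i != j ->
  dfwith (dfwith t k) l = dfwith (dfwith t l) k.
Proof.
move=> ij; apply: functional_extensionality_dep => m.
have [<-|jm] := eqVneq j m; first by rewrite dfwith_in dfwith_out // dfwith_in.
rewrite dfwith_out //; have [<-|im] := eqVneq i m; first by rewrite !dfwith_in.
by rewrite !dfwith_out.
Qed.

Lemma dfwith_id (t : T) i : dfwith t (t i) = t.
Proof.
apply: functional_extensionality_dep => j.
by case: (dfwithP t (t i) j).
Qed.

Lemma coord_signK t i : coord_sign t i * coord_sign t i = 1.
Proof. by rewrite -expr2 sqrr_sign. Qed.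

Lemma coord_sign_ge (t : T) (i j : 'I_n) (k : K i) : (j <= i)%N ->
  coord_sign (dfwith t k) j = coord_sign t j.
Proof.
move=> ji; congr (_ ^+ _); apply: eq_bigr => l lj; rewrite dfwith_out //.
by apply: contraTneq lj => <-; rewrite -leqNgt.
Qed.

Lemma coord_sign_lt (t : T) (i j : 'I_n) (k : K i) :
  (i < j)%N -> odd (wt k) = ~~ odd (wt (t i)) ->
  coord_sign (dfwith t k) j = - coord_sign t j.
Proof.
move=> ij kt; rewrite /coord_sign (bigD1 i) // [in RHS](bigD1 i) //= dfwith_in.
rewrite (eq_bigr (fun l => wt (t l))) => [|l /andP[_ li]]; last first.
  by rewrite dfwith_out // eq_sym.
by rewrite !exprD -mulNr -[in LHS]signr_odd -[in RHS]signr_odd kt signrN.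
Qed.

Lemma coord_op_subst t i (A : {additive {freeg (K i) / int} -> {freeg (K i) / int}}) c :
  coord_op _ A (subst_coord t i c) = coord_sign t i *: subst_coord t i (A c).
Proof.
pose f : {additive {freeg (K i) / int} -> V} := coord_op i A \o subst_coord t i.
pose g : {additive {freeg (K i) / int} -> V} :=
  ( *:%R (coord_sign t i)) \o (subst_coord t i \o A).
apply: (@freeg_ext _ _ f g) => k; rewrite /f /g /= {1}/subst_coord fgliftU.
rewrite /coord_op fgliftU coord_sign_ge // dfwith_in; congr (_ *: _).
rewrite /subst_coord !fgliftE; apply: eq_bigr => l _; rewrite dfwith_twice //.
Qed.

Lemma coord_opU i A t :
  coord_op i A << t >> = coord_sign t i *: subst_coord t i (A << t i >>).
Proof. exact: fgliftU. Qed.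

(** Both operators carry the same sign, which depends only on the coordinates before [i], and the
    two signs cancel. *)
Lemma coord_opM i (A B : {additive {freeg (K i) / int} -> {freeg (K i) / int}}) t :
  coord_op _ A (coord_op _ B << t >>) = subst_coord t i (A (B << t i >>)).
Proof.
rewrite coord_opU int_scalerE raddfMz /= coord_op_subst.
by rewrite -int_scalerE scalerA coord_signK scale1r.
Qed.

Lemma coord_op_subst_out t (i j : 'I_n)
    (B : {additive {freeg (K j) / int} -> {freeg (K j) / int}}) c : i != j ->
  coord_op j B (subst_coord t i c) =
  \sum_(k <- dom c) \sum_(l <- dom (B << t j >>))
    (coord_sign (dfwith t k) j * (coeff k c * coeff l (B << t j >>))) *:
      << dfwith (dfwith t k) l >>.
Proof.
move=> ij; rewrite /subst_coord fgliftE raddf_sum; apply: eq_bigr => k _.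
rewrite /= int_scalerE raddfMz /= coord_opU -int_scalerE scalerA mulrC.
rewrite /subst_coord fgliftE dfwith_out // scaler_sumr; apply: eq_bigr => l _.
by rewrite scalerA mulrA.
Qed.

(** Acting on [i] changes by an odd amount one of the degrees counted in the sign of [j], while
    acting on [j] leaves the sign of [i] alone: the two orders differ by exactly one sign. *)
Lemma coord_op_anticomm (i j : 'I_n)
    (A : {additive {freeg (K i) / int} -> {freeg (K i) / int}})
    (B : {additive {freeg (K j) / int} -> {freeg (K j) / int}}) x :
  (i < j)%N -> odd_op A ->
  coord_op j B (coord_op i A x) = - coord_op i A (coord_op j B x).
Proof.
move=> ij oddA.
apply: (@freeg_ext _ _ (coord_op j B \o coord_op i A)
                       (-%R \o (coord_op i A \o coord_op j B))) => {x}t /=.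
have nij : i != j by rewrite -val_eqE ltn_eqF.
rewrite !coord_opU !(int_scalerE (coord_sign t _)) !raddfMz /=.
rewrite coord_op_subst_out // coord_op_subst_out 1?eq_sym // exchange_big /=.
rewrite -!int_scalerE -sumrN !scaler_sumr; apply: eq_bigr => l _.
rewrite -sumrN !scaler_sumr; apply: eq_big_seq => k /oddA kt.
rewrite coord_sign_lt // coord_sign_ge 1?ltnW // scalerN !scalerA dfwithC // -scaleNr.
congr (_ *: _); rewrite mulNr mulrN; congr (- _).
by rewrite mulrCA [coeff l _ * _]mulrC.
Qed.

Lemma coord_sum_regular
    (d h : forall i, {additive {freeg (K i) / int} -> {freeg (K i) / int}}) :
    (forall i, odd_op (d i)) -> (forall i, odd_op (h i)) ->
    (forall i x, d i (d i x) = 0) -> (forall i x, d i (h i (d i x)) = d i x) ->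
  exists H : {additive V -> V},
    forall x, \sum_i coord_op i (d i) (H (\sum_i coord_op i (d i) x)) =
              \sum_i coord_op i (d i) x.
Proof.
move=> oddd oddh dd0 dhd.
apply: (@sum_ord_regular _ _ (fun i => coord_op i (d i)) (fun i => coord_op i (h i))).
- move=> i x.
  apply: (@freeg_ext _ _ (coord_op i (d i) \o coord_op i (d i)) \0) => t /=.
  by rewrite coord_opM dd0 raddf0.
- by move=> i j x ij; apply: coord_op_anticomm.
- by move=> i j x ij; apply: coord_op_anticomm.
- by move=> i j x ij; apply: coord_op_anticomm.
- move=> i x.
  apply: (@freeg_ext _ _ (coord_op i (d i) \o (coord_op i (h i) \o coord_op i (d i)))
                         (coord_op i (d i))) => t /=.
  rewrite coord_opM coord_op_subst dhd coord_opU //.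
Qed.

End CoordinateOperators.

(** * Differentials that map generators to differences of generators *)

Section DifferencesOfBasisElements.
Variables (K : choiceType) (wt : K -> nat).
Let C := {freeg K / int}.
Variable d : {additive C -> C}.

Let e (a : option K) : C := if a is Some v then << v >> else 0.
Let opposite_parity (k : K) (a : option K) :=
  forall v, a = Some v -> odd (wt v) = ~~ odd (wt k).

Hypothesis d_basis : forall k, exists a b,
  [/\ d << k >> = e a - e b, opposite_parity k a & opposite_parity k b].

(** The first parity clause makes the inverse assembled from such chains an odd operator; the second
    lets chains be concatenated. *)
Let joins (v : K) (a : option K) (c : C) :=
  [/\ d c = << v >> - e a, forall k, k \in dom c -> odd (wt k) = ~~ odd (wt v)
    & forall w, a = Some w -> odd (wt w) = odd (wt v)].

(* A class is the set of generators, and possibly zero ([None]), that are congruent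
   to [v] modulo boundaries; the generalized inverse maps [v] to a chain with
   boundary [v - rep v]. *)
Let class (v : K) : set (option K) := [set a | exists c, joins v a c].

Let class_sub v w : class v (Some w) -> class w `<=` class v.
Proof.
move=> [c [dc cv /(_ _ erefl) wv]] a [c' [dc' cw aw]]; exists (c + c'); split.
- by rewrite raddfD dc dc' addrA subrK.
- move=> k /domD_subset; rewrite mem_cat => /orP[/cv //|/cw ->]; by rewrite wv.
- by move=> u /aw ->.
Qed.

Let class_sym v w : class v (Some w) -> class w (Some v).
Proof.
move=> [c [dc cv /(_ _ erefl) wv]]; exists (- c); split => //.
- by rewrite raddfN dc opprB.
- by move=> k; rewrite domN => /cv ->; rewrite wv.
- by move=> _ [<-].
Qed.

Let class_eq v w : class v (Some w) -> class v = class w.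
Proof. by move=> vw; apply/seteqP; split; apply: class_sub => //; exact: class_sym. Qed.

(** Zero takes precedence, so that generators congruent to zero are represented by zero; otherwise
    the choice depends only on the class as a set, and is common to its members. *)
Let rep v := if `[< class v None >] then None else xget None (class v).

Let rep_class v : class v (rep v).
Proof.
rewrite /rep; case: asboolP => // _; apply: (@xgetPex _ None); exists (Some v), 0.
by split=> [|k|_ [<-]] //; rewrite ?raddf0 ?subrr // dom0.
Qed.

(** The inverse satisfies [d (h v) = v - rep v]. In [d k = a - b] the terms [a] and [b] are
    congruent, so their representatives agree and cancel. *)
Lemma basis_difference_regular : exists h : {additive C -> C},
  (forall k k', k' \in dom (h << k >>) -> odd (wt k') = ~~ odd (wt k)) /\
  forall x, d (h (d x)) = d x.
Proof.
pose f v := projT1 (cid (rep_class v)).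
have fP v : joins v (rep v) (f v) by exact: (projT2 (cid (rep_class v))).
pose h : {additive C -> C} := fglift f.
exists h; split=> [k k'|x].
  by rewrite /h /= fgliftU; have [_ + _] := fP k; apply.
apply: (@freeg_ext _ _ (d \o (h \o d)) d) => {x}k /=.
have [a [b [dk ak bk]]] := d_basis k; rewrite dk raddfB raddfB /=.
have dh v : d (h << v >>) = << v >> - e (rep v).
  by rewrite /h /= fgliftU; have [] := fP v.
have rep0 v : class v None -> rep v = None by rewrite /rep => /asboolT ->.
case: a b dk ak bk => [v|] [w|] dk /= ak bk.
- rewrite !dh; suff -> : rep v = rep w by rewrite opprB addrA subrK.
  suff vw : class v (Some w) by rewrite /rep (class_eq vw).
  exists << k >>; split => //.
    by move=> k'; rewrite domU1 inE => /eqP ->; rewrite (ak _ erefl) negbK.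
  by move=> _ [<-]; rewrite (bk _ erefl) (ak _ erefl).
- rewrite (raddf0 h) raddf0 !subr0 dh rep0 /= ?subr0 //; exists << k >>; split => //.
  by move=> k'; rewrite domU1 inE => /eqP ->; rewrite (ak _ erefl) negbK.
- rewrite (raddf0 h) raddf0 !sub0r dh rep0 /= ?subr0 //; exists (- << k >>); split => //.
    by rewrite raddfN dk /= opprB.
  by move=> k'; rewrite domN domU1 inE => /eqP ->; rewrite (bk _ erefl) negbK.
- by rewrite !subrr.
Qed.
End DifferencesOfBasisElements.

(** * Faces of a cornered space *)

Section Faces.
Variables (R : realType) (Y : cornered_space R).
Implicit Types (f g : set (ambient Y)) (x y : ambient Y) (I J : {set 'I_(nhyp Y)}).

Definition zeros x : {set 'I_(nhyp Y)} := [set j | defun j x == 0]%SET.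

Definition part J : set (ambient Y) := [set x | carrier Y x /\ zeros x = J].

(** Recording the index set, and not just its cardinality, is what decomposes along products;
    [facesP] reconciles this with [faces]. *)
Definition is_face J f := exists2 x, part J x & f = connected_component (part J) x.

Definition continuous_defun := forall j : 'I_(nhyp Y), continuous (@defun R Y j).

Lemma part_sub_stratum J : part J `<=` stratum Y #|J|.
Proof. by move=> x [Yx <-]. Qed.

Lemma is_face_sub J f : is_face J f -> f `<=` part J.
Proof. by move=> [x _ ->]; exact: connected_component_sub. Qed.

Lemma is_face_connected J f : is_face J f -> connected f.
Proof. by move=> [x _ ->]; exact: component_connected. Qed.

Lemma is_face_neq0 J f : is_face J f -> f !=set0.
Proof. by move=> [x Jx ->]; exists x; exact: connected_component_refl. Qed.

Lemma is_face_component J f x : is_face J f -> f x -> f = connected_component (part J) x.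
Proof. by move=> [y Jy ->]; exact: same_connected_component. Qed.

Lemma is_face_max J f (B : set (ambient Y)) : is_face J f -> B `&` f !=set0 ->
  connected B -> B `<=` part J -> B `<=` f.
Proof.
move=> fJ [x [Bx fx]] cB BJ; rewrite (is_face_component fJ fx).
exact: connected_component_max.
Qed.

Lemma is_face_eq J f g : is_face J f -> is_face J g -> f `&` g !=set0 -> f = g.
Proof.
move=> fJ gJ [x [fx gx]].
by rewrite (is_face_component fJ fx) (is_face_component gJ gx).
Qed.

Lemma face_idxE J f : is_face J f -> face_idx f = J.
Proof.
move=> fJ; apply/setP => i; rewrite inE; apply/asboolP/idP => [fi|iJ x fx].
  have [x fx] := is_face_neq0 fJ; have [_ /eqP] := fi x fx.
  by have [_ <-] := is_face_sub fJ fx; rewrite inE.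
have [Yx xJ] := is_face_sub fJ fx; split => //.
by apply/eqP; move: iJ; rewrite -xJ inE.
Qed.

Hypothesis Ycont : continuous_defun.

Lemma open_defun_neq0 J : open [set x | forall j, j \in J -> @defun R Y j x != 0].
Proof.
rewrite openE => x /= xJ; apply: filter_forall => j.
have [jJ|jJ] := boolP (j \in J); last by apply: nearW => y yj; case/negP: jJ.
by apply: filterS (cvgr_neq0 _ (@Ycont j x) (xJ j jJ)) => y.
Qed.

Lemma closed_defun_eq0 J : closed [set x | forall j, j \in J -> @defun R Y j x = 0].
Proof.
rewrite (_ : [set x | _] = \bigcap_(j in [set j | j \in J]) (@defun R Y j @^-1` [set 0])).
  apply: closed_bigI => j _; apply: closed_comp => [x _|]; first exact: Ycont.
  exact: closed_eq.
by apply/seteqP; split=> x /= xJ j /xJ.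
Qed.

(** Since the number of zeros is constant on [B], either inclusion between [zeros z] and [zeros x]
    is an equality. The locus of equality is thus closed in [B] (the functions of [x] vanish) and
    open (the others do not). *)
Lemma connected_zeros (B : set (ambient Y)) p x :
  connected B -> B `<=` stratum Y p -> B x -> B `<=` part (zeros x).
Proof.
move=> cB Bp Bx y By.
have zB z : B z -> #|zeros z| = #|zeros x|.
  by move=> Bz; have [_] := Bp z Bz; have [_ <-] := Bp x Bx.
pose E := B `&` [set z | forall j, j \in zeros x -> @defun R Y j z = 0].
suff EB : E = B.
  split; first by case: (Bp y By).
  move: By; rewrite -EB => -[By yx]; apply/esym/eqP; rewrite eqEcard zB // leqnn andbT.
  by apply/fintype.subsetP => j /yx; rewrite inE => ->.
apply: cB.
- by exists x; split => // j; rewrite inE => /eqP.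
- exists [set z | forall j, j \in ~: zeros x -> @defun R Y j z != 0].
    exact: open_defun_neq0.
  apply/seteqP; split=> z [Bz zx]; split => // j.
    have : zeros z = zeros x.
      apply/esym/eqP; rewrite eqEcard zB // leqnn andbT.
      by apply/fintype.subsetP => i /zx; rewrite inE => ->.
    by rewrite !inE => /setP/(_ j); rewrite !inE => <-.
  have : zeros z = zeros x.
    apply/eqP; rewrite eqEcard zB // leqnn andbT; apply/fintype.subsetP => i.
    by apply: contraTT => ix; rewrite inE zx // inE.
  by move=> <-; rewrite inE => /eqP.
- exists [set z | forall j, j \in zeros x -> @defun R Y j z = 0] => //.
  exact: closed_defun_eq0.
Qed.

(** By [connected_zeros], a connected subset of a stratum that meets [part J] stays in it, so the
    components are the same. *)
Lemma facesP p f : faces Y p f <-> exists2 J : {set _}, #|J| = p & is_face J f.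
Proof.
split=> [[x xp <-]|[J <- [x Jx ->]]].
  have [Yx zp] := xp.
  exists (zeros x) => //; exists x => //.
  apply/seteqP; split; apply: connected_component_max.
  - exact: connected_component_refl.
  - apply: connected_zeros; first exact: component_connected.
      exact: connected_component_sub.
    exact: connected_component_refl.
  - exact: component_connected.
  - exact: connected_component_refl.
  - by apply: subset_trans; [exact: connected_component_sub|rewrite -zp;
      exact: part_sub_stratum].
  - exact: component_connected.
exists x; first exact: part_sub_stratum.
have xJ : zeros x = J by case: Jx.
apply/seteqP; split; apply: connected_component_max.
- exact: connected_component_refl (part_sub_stratum Jx).
- rewrite -[in part _]xJ; apply: connected_zeros; first exact: component_connected.
    exact: connected_component_sub.
  exact: connected_component_refl (part_sub_stratum Jx).
- exact: component_connected.
- exact: connected_component_refl.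
- by apply: subset_trans; [exact: connected_component_sub|exact: part_sub_stratum].
- exact: component_connected.
Qed.

End Faces.

(** * Faces whose closure contains a given face *)

Section Cofaces.
Variables (R : realType) (Y : cornered_space R).
Implicit Types (f g : set (ambient Y)) (x y : ambient Y) (I J K : {set 'I_(nhyp Y)}).

(* Near [x] the space looks like a product of a linear space and of half-lines, one
   for each defining function that vanishes at [x]; only the connectedness and
   the nonemptiness of the strata are needed. *)
Definition locally_conical := forall x, carrier Y x -> forall J, J \subset zeros x ->
  forall W, nbhs x W -> exists U,
    [/\ nbhs x U, U `<=` W, connected (part J `&` U) & part J `&` U !=set0].

Definition unique_cofaces := forall I J f, is_face I f -> J \subset I ->
  exists! g, is_face J g /\ f `<=` closure g.

(** Near a point of [f] the stratum of [J] is connected and nonempty, so exactly one of its faces is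
    adherent there. This local coface is locally constant along [f], hence constant, [f] being
    connected. *)
Lemma locally_conical_unique_cofaces : locally_conical -> unique_cofaces.
Proof.
move=> con I J f fI JI.
have loc x : f x -> exists U g, [/\ nbhs x U, is_face J g,
    forall g' y, is_face J g' -> U° y -> closure g' y -> g' = g &
    forall y, U° y -> f y -> closure g y].
  move=> fx; have [Yx xI] := is_face_sub fI fx.
  have [|U [xU _ JUc [z JUz]]] := con x Yx J _ setT (filterT).
    by rewrite xI.
  exists U, (connected_component (part J) z).
  have gJ : is_face J (connected_component (part J) z) by exists z => //; case: JUz.
  have gz : (part J `&` U) `&` connected_component (part J) z !=set0.
    by exists z; split => //; apply: connected_component_refl; case: JUz.
  have JUg := is_face_max gJ gz JUc (@subIsetl _ _ _).
  split=> //.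
    move=> g' y g'J Uy /(_ U Uy)[w [g'w Uw]].
    apply: (is_face_eq g'J gJ); exists w; split => //; apply: JUg; split => //.
    exact: (is_face_sub g'J).
  (* Conicality is used again, at [y]: it gives points of [part J] arbitrarily close to [y], which
     lie in the component found at [x] as soon as they are in [U]. *)
  move=> y Uy fy N yN; have [Yy yI] := is_face_sub fI fy.
  have [|U' [_ U'NU _ [w [Jw U'w]]]] := con y Yy J _ (N `&` U) (filterI yN Uy).
    by rewrite yI.
  have [Nw Uw] := U'NU w U'w.
  by exists w; split => //; apply: JUg.
have [x fx] := is_face_neq0 fI; have [U [g [xU gJ gU fg]]] := loc x fx.
have Ux : U° x by [].
exists g; split; last by move=> g' [g'J fg']; apply/esym/(gU g' x) => //; apply: fg'.
split=> //; suff <- : f `&` closure g = f by exact: subIsetr.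
apply: (is_face_connected fI).
- by exists x; split => //; exact: fg.
- exists [set y | f y -> closure g y]°; first exact: open_interior.
  apply/seteqP; split=> y [fy gy]; split => //.
    have [V [g' [yV g'J g'V fg']]] := loc y fy.
    have -> : g = g' by apply: g'V gy.
    by apply: filterS (nbhs_interior yV) => z Vz fz; exact: fg'.
  exact: (interior_subset gy fy).
- by exists (closure g) => //; exact: closed_closure.
Qed.

Hypothesis Yc : unique_cofaces.

(** Meaningful when [f] is a face whose index set contains [J]; [set0] is only a default. *)
Definition coface J f := xget set0 [set g | is_face J g /\ f `<=` closure g].

Lemma cofaceP I J f : is_face I f -> J \subset I ->
  is_face J (coface J f) /\ f `<=` closure (coface J f).
Proof. move=> fI /(Yc fI)[g [gP _]].
by apply: (@xgetPex _ set0 [set g | is_face J g /\ f `<=` closure g]); exists g. Qed.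

Lemma coface_is_face I J f : is_face I f -> J \subset I -> is_face J (coface J f).
Proof. by move=> fI /(cofaceP fI)[]. Qed.

Lemma coface_eq I J f g : is_face I f -> J \subset I -> is_face J g ->
  f `<=` closure g -> g = coface J f.
Proof.
move=> fI JI gJ fg; have [h [_ h_uniq]] := Yc fI JI.
by rewrite -(h_uniq g) // -(h_uniq (coface J f)) //; apply: cofaceP fI JI.
Qed.

Lemma coface_id J f : is_face J f -> coface J f = f.
Proof.
by move=> fJ; apply/esym/(coface_eq fJ) => //; exact: subset_closure.
Qed.

(** Closure is monotone and idempotent, so [f] lies in the closure of the iterated coface, and
    uniqueness concludes. *)
Lemma coface_coface I J K f : is_face I f -> J \subset I -> K \subset J ->
  coface K (coface J f) = coface K f.
Proof.
move=> fI JI KJ; have gJ := coface_is_face fI JI.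
apply: (coface_eq fI (fintype.subset_trans KJ JI) (coface_is_face gJ KJ)).
apply: subset_trans (proj2 (cofaceP fI JI)) _.
have := closureS (proj2 (cofaceP gJ KJ)).
by rewrite -((closure_id _).1 (@closed_closure _ (coface K (coface J f)))).
Qed.

End Cofaces.

(** * The conormal differential as a sum over cofaces *)

Section Differential.
Variables (R : realType) (Y : cornered_space R).
Implicit Types (f g : set (ambient Y)) (x y : ambient Y) (I J K : {set 'I_(nhyp Y)}).
Hypothesis Ycont : continuous_defun Y.
Hypothesis Yc : unique_cofaces Y.

(** The functions indexed by [J] vanish on [g], hence on its closure. *)
Lemma is_face_closure_idx I J f g : is_face I f -> is_face J g -> f `<=` closure g ->
  J \subset I.
Proof.
move=> fI gJ fg; apply/fintype.subsetP => j jJ.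
have [x fx] := is_face_neq0 fI; have [_ <-] := is_face_sub fI fx.
have gZ : g `<=` [set y | forall j, j \in J -> @defun R Y j y = 0].
  by move=> y gy k; have [_ <-] := is_face_sub gJ gy; rewrite inE => /eqP.
have := closureS gZ (fg x fx).
rewrite -((closure_id _).1 (closed_defun_eq0 (J := J) Ycont)) => /(_ j jJ) xj.
by rewrite inE xj.
Qed.

(* The differential of the conormal complex, extended by zero to the free group on
   all sets, so that it does not mention the degree. *)
Definition face_boundary f : {freeg (set (ambient Y)) / int} :=
  if `[< exists J, is_face J f >] then
    \sum_(k in face_idx f) << contr_coef k (face_idx f) *g coface (face_idx f :\ k) f >>
  else 0.

Lemma face_boundaryE I f : is_face I f ->
  face_boundary f = \sum_(k in I) << contr_coef k I *g coface (I :\ k) f >>.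
Proof.
by move=> fI; rewrite /face_boundary asboolT ?(face_idxE fI) //; exists I.
Qed.

(** A projection onto degree [p], which kills the sets that are not faces of that codimension. *)
Definition chain_of p f : chain Y p := if insub f is Some g then << g >> else 0.

(** The faces of codimension [p] with [f] in their closure are the cofaces for the sets [I :\ k];
    they are distinct for distinct [k], because a face determines its index set. *)
Lemma deltaE p (f : faces Y p.+1) :
  delta_gen f = fglift (@chain_of p) (face_boundary (val f)).
Proof.
have /set_mem/(facesP Ycont)[I Ip fI] := valP f.
have [k0 k0I] : exists k, k \in I by apply/set0Pn; rewrite -card_gt0 Ip.
have cofI k : k \in I -> is_face (I :\ k) (coface (I :\ k) (val f)).
  by move=> kI; apply: (coface_is_face Yc fI (subD1set _ _)).
have faceI k : k \in I -> coface (I :\ k) (val f) \in faces Y p.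
  move=> kI; apply/mem_set/(facesP Ycont); exists (I :\ k); last exact: cofI.
  by move: Ip; rewrite (cardsD1 k) kI => -[].
(* A default for [insubd], available because [I] has [p.+1] elements. *)
pose g0 : faces Y p :=
  exist (fun g => g \in faces Y p) _ (faceI k0 k0I).
pose gk k := insubd g0 (coface (I :\ k) (val f)).
have gkE k : k \in I -> val (gk k) = coface (I :\ k) (val f).
  by move=> kI; rewrite /gk val_insubd faceI.
have gk_inj : {in I &, injective gk}.
  move=> k l kI lI /(congr1 val); rewrite !gkE // => kl.
  have := face_idxE (cofI k kI); rewrite kl (face_idxE (cofI l lI)) => /setP/(_ k).
  by rewrite !inE eqxx kI andbT /= => /negbFE/eqP.
rewrite (face_boundaryE fI) raddf_sum /=.
have -> : [set g : faces Y p | val f `<=` closure (val g)] =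
          [set` [seq gk k | k <- enum I]].
  apply/seteqP; split => g /=.
    have /set_mem/(facesP Ycont)[J Jp gJ] := valP g.
    move=> fg; have JI := is_face_closure_idx fI gJ fg.
    have /cards1P[k IJk] : #|I :\: J| == 1%N.
      by rewrite cardsD (finset.setIidPr JI) Jp Ip subSnn.
    have kI : k \in I by have /setP/(_ k) := IJk; rewrite !inE eqxx => /andP[].
    have JE : J = I :\ k.
      by rewrite -IJk finset.setDDr finset.setDv finset.set0U (finset.setIidPr JI).
    apply/mapP; exists k; first by rewrite mem_enum.
    apply: val_inj; rewrite gkE // -JE; exact: (coface_eq Yc fI).
  move=> /mapP[k]; rewrite mem_enum => kI ->; rewrite gkE //.
  exact: (proj2 (cofaceP Yc fI (subD1set _ _))).
rewrite -fsbig_seq ?map_inj_in_uniq ?enum_uniq //; last first.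
  by move=> k l; rewrite !mem_enum; exact: gk_inj.
rewrite big_map big_enum /=; apply: eq_bigr => k kI.
rewrite liftU /chain_of; case: insubP => [g gp gE|]; last by rewrite faceI.
have -> : gk k = g by apply: val_inj; rewrite gkE // gE.
rewrite freegUE int_scalerE freegUE; congr (_ *~ _).
rewrite /incidence gE (face_idxE fI) (face_idxE (cofI k kI)).
case: pickP => [l|/(_ k)]; last by rewrite !inE eqxx kI.
by rewrite !inE; case: eqVneq => [->|] //=; case: (l \in I).
Qed.

End Differential.

(** * Conormal complexes in codimension at most two *)

Section CodimensionTwo.
Variables (R : realType) (Y : cornered_space R).
Implicit Types (f g : set (ambient Y)) (x y : ambient Y) (I J K : {set 'I_(nhyp Y)}).
Hypothesis Ycont : continuous_defun Y.
Hypothesis Yc : unique_cofaces Y.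
Hypothesis Ycodim : (codim Y <= 2)%N.

Lemma is_face_card_le2 I f : is_face I f -> (#|I| <= 2)%N.
Proof.
move=> fI; apply: leq_trans Ycodim.
have In : (#|I| < (nhyp Y).+1)%N by rewrite ltnS -[leqRHS]card_ord max_card.
apply: (@leq_bigmax_cond _ _ (fun p : 'I_(nhyp Y).+1 => nat_of_ord p) (Ordinal In)).
by apply/asboolP; exists f; apply/(facesP Ycont); exists I.
Qed.

Lemma contr_coef_least i I : i \in I -> (forall j, j \in I -> (i <= j)%N) ->
  contr_coef i I = 1.
Proof.
move=> iI imin; rewrite /contr_coef iI (_ : [set k in I | _]%SET = finset.set0) ?cards0 //.
apply/setP => j; rewrite !inE; apply/negP => /andP[/imin]; by rewrite leqNgt => /negP.
Qed.

Lemma face_boundary_nonface f : ~ (exists J, is_face J f) -> face_boundary f = 0.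
Proof. by move=> fN; rewrite /face_boundary asboolF. Qed.

Lemma face_boundary0 f : is_face finset.set0 f -> face_boundary f = 0.
Proof. by move=> /face_boundaryE ->; rewrite big1 // => k; rewrite inE. Qed.

Lemma face_boundary1 i f : is_face [set i]%SET f ->
  face_boundary f = << coface finset.set0 f >>.
Proof.
move=> /face_boundaryE ->; rewrite big_set1 contr_coef_least ?inE //.
  by rewrite finset.setDv.
by move=> j; rewrite inE => /eqP ->.
Qed.

Lemma face_boundary2 (i j : 'I_(nhyp Y)) f : (i < j)%N -> is_face [set i; j]%SET f ->
  face_boundary f = << coface [set j]%SET f >> - << coface [set i]%SET f >>.
Proof.
move=> ij fij; have ji : i != j by rewrite -val_eqE ltn_eqF.
rewrite (face_boundaryE fij) big_setU1 /= ?inE // big_set1.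
have -> : [set i; j]%SET :\ i = [set j]%SET.
  by apply/setP => k; rewrite !inE; case: eqVneq => [->|]; rewrite ?(negPf ji).
have -> : [set i; j]%SET :\ j = [set i]%SET.
  apply/setP => k; rewrite !inE; case: (eqVneq k j) => [->|]; rewrite ?orbF //.
  by rewrite eq_sym (negPf ji).
rewrite contr_coef_least ?inE ?eqxx //; last first.
  by move=> k; rewrite !inE => /orP[] /eqP -> //; exact: ltnW.
rewrite freegUN; congr (_ + << _ *g _ >>).
rewrite /contr_coef !inE eqxx orbT (_ : [set k in _ | _]%SET = [set i]%SET) ?cards1 //.
apply/setP => k; rewrite !inE; case: (eqVneq k i) => [->|] /=; first by rewrite ij.
by move=> _; case: eqVneq => // ->; rewrite ltnn.
Qed.

(** The first case covers both codimension zero and the sets that are not faces. *)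
Variant face_boundary_spec f : {freeg (set (ambient Y)) / int} -> Prop :=
| FaceBoundary0 : face_boundary_spec f 0
| FaceBoundary1 i of is_face [set i]%SET f :
    face_boundary_spec f << coface finset.set0 f >>
| FaceBoundary2 (i j : 'I_(nhyp Y)) of (i < j)%N & is_face [set i; j]%SET f :
    face_boundary_spec f (<< coface [set j]%SET f >> - << coface [set i]%SET f >>).

Lemma face_boundaryP f : face_boundary_spec f (face_boundary f).
Proof.
have [[I fI]|fN] := pselect (exists J, is_face J f); last first.
  rewrite face_boundary_nonface //; constructor.
have := is_face_card_le2 fI; rewrite leq_eqVlt ltnS => /orP[/cards2P[i [j [ij IE]]]|].
  wlog {ij} ij : i j IE / (i < j)%N => [IH|].
    move: ij; rewrite -val_eqE neq_ltn => /orP[]; first exact: (IH i j IE).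
    by apply: (IH j i); rewrite IE finset.setUC.
  by rewrite IE in fI; rewrite (face_boundary2 ij) //; exact: FaceBoundary2 fI.
rewrite leq_eqVlt ltnS leqn0 => /orP[/cards1P[i IE]|/eqP/cards0_eq I0].
  by rewrite IE in fI; rewrite (face_boundary1 fI); exact: FaceBoundary1 fI.
by rewrite I0 in fI; rewrite face_boundary0 //; constructor.
Qed.

(** The two codimension-one cofaces of a codimension-two face share their coface of empty index set,
    and enter with opposite signs. *)
Lemma face_boundary_square f : fglift (@face_boundary _ Y) (face_boundary f) = 0.
Proof.
have sub1 (i j : 'I_(nhyp Y)) : [set i]%SET \subset [set i; j]%SET.
  by rewrite finset.sub1set !inE eqxx.
have sub2 (i j : 'I_(nhyp Y)) : [set j]%SET \subset [set i; j]%SET.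
  by rewrite finset.sub1set !inE eqxx orbT.
case: face_boundaryP => [|i fi|i j ij fij]; first by rewrite raddf0.
  by rewrite fgliftU face_boundary0 //; apply: (coface_is_face Yc fi);
      exact: finset.sub0set.
rewrite raddfB /= !fgliftU.
have fi := coface_is_face Yc fij (sub1 i j); have fj := coface_is_face Yc fij (sub2 i j).
rewrite (face_boundary1 fi) (face_boundary1 fj) !(coface_coface Yc fij);
  rewrite ?finset.sub0set //.
by rewrite subrr.
Qed.

Lemma face_boundary_regular :
  exists h : {additive {freeg (set (ambient Y)) / int} ->
                {freeg (set (ambient Y)) / int}},
    (forall f g, g \in dom (h << f >>) -> odd #|face_idx g| = ~~ odd #|face_idx f|) /\
    forall c, fglift (@face_boundary _ Y) (h (fglift (@face_boundary _ Y) c)) =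
              fglift (@face_boundary _ Y) c.
Proof.
apply: (@basis_difference_regular _ (fun f => #|face_idx f|)
    (fglift (@face_boundary _ Y))).
move=> f; rewrite /= fgliftU.
case: face_boundaryP => [|i fi|i j ij fij].
- by exists None, None; split; rewrite ?subr0.
- exists (Some (coface finset.set0 f)), None; split; rewrite ?subr0 // => _ [<-].
  by rewrite (face_idxE fi) (face_idxE (coface_is_face Yc fi (finset.sub0set _)))
      cards0 cards1.
- exists (Some (coface [set j]%SET f)), (Some (coface [set i]%SET f)).
  have ji : i != j by rewrite -val_eqE ltn_eqF.
  have fi : is_face [set i]%SET (coface [set i]%SET f).
    by apply: (coface_is_face Yc fij); rewrite finset.sub1set !inE eqxx.
  have fj : is_face [set j]%SET (coface [set j]%SET f).
    by apply: (coface_is_face Yc fij); rewrite finset.sub1set !inE eqxx orbT.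
  by split=> // _ [<-]; rewrite (face_idxE fij) ?(face_idxE fi) ?(face_idxE fj) cards2
      cards1 ji.
Qed.

End CodimensionTwo.

Lemma dom_face_boundary (R : realType) (Y : cornered_space R) (Yc : unique_cofaces Y)
    (f g : set (ambient Y)) :
  g \in dom (face_boundary f) -> odd #|face_idx g| = ~~ odd #|face_idx f|.
Proof.
have [[I fI]|fN] := pselect (exists J, is_face J f); last first.
  by rewrite /face_boundary asboolF // dom0.
rewrite (face_boundaryE fI) => /dom_sum_subset/flattenP[_ /mapP[k + ->]].
rewrite mem_filter => /andP[kI _].
rewrite domU => [|]; last by rewrite /contr_coef kI signr_eq0.
rewrite inE => /eqP ->.
rewrite (face_idxE fI) (face_idxE (coface_is_face Yc fI (subD1set _ _))).
by rewrite [in RHS](cardsD1 k) kI /= negbK.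
Qed.

(** * Products *)

Section ProductTopology.
Variables (n : nat) (Z : 'I_n -> topologicalType).
Let PZ := prod_topology Z.
Implicit Types (A : forall i, set (Z i)) (x y z : forall i, Z i).

Definition box A : set PZ := [set x | forall i, A i (x i)].

Let put z i : Z i -> PZ := fun a => dfwith z a.

Let put_continuous z i : continuous (@put z i).
Proof. exact: (@dfwith_continuous _ _ z i). Qed.

(** A nonempty subset open and closed in the box contains, with a point, its whole slice along each
    coordinate; any point is then reached by changing coordinates one at a time. *)
Lemma connected_box A : (forall i, connected (A i)) -> connected (box A).
Proof.
move=> cA B [x Bx] [C oC BC] [D cD BD].
have BA : B `<=` box A by rewrite BC => ? [].
have slice (z : PZ) i a : B z -> A i a -> B (dfwith z a).
  move=> Bz Aa.
  have Ez : A i `&` @put z i @^-1` B = A i.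
    have AB b : A i b -> box A (dfwith z b).
      by move=> Ab j; case: dfwithP => // j' _; apply: BA.
    apply: cA.
    - exists (z i); split; first exact: BA.
      by rewrite /preimage /put /= dfwith_id.
    - exists (@put z i @^-1` C); first by apply: open_comp oC => b _;
        exact: put_continuous.
      apply/seteqP; split=> b [Ab]; rewrite /preimage /put /= BC; first by case.
      by move=> Cb; split => //; split => //; exact: AB.
    - exists (@put z i @^-1` D); first by apply: closed_comp cD => b _;
        exact: put_continuous.
      apply/seteqP; split=> b [Ab]; rewrite /preimage /put /= BD; first by case.
      by move=> Cb; split => //; split => //; exact: AB.
  by move: Aa; rewrite -Ez => -[].
apply/seteqP; split=> // y Ay.
suff : forall k, B (fun i : 'I_n => if (i < k)%N then y i else x i).
  move=> /(_ n); congr B; apply: functional_extensionality_dep => i.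
  by rewrite ltn_ord.
elim=> [|k IHk].
  by move: Bx; congr B; apply: functional_extensionality_dep => i.
have [kn|nk] := ltnP k n; last first.
  move: IHk; congr B; apply: functional_extensionality_dep => i.
  by rewrite (leq_trans (ltn_ord i) nk) ltnS ltnW // (leq_trans (ltn_ord i) nk).
have := slice _ (Ordinal kn) (y (Ordinal kn)) IHk (Ay _).
congr B; apply: functional_extensionality_dep => i.
case: dfwithP => [|j]; first by rewrite ltnSn.
by rewrite -val_eqE /= eq_sym => jk; rewrite [in RHS]ltnS [in RHS]leq_eqVlt (negPf jk).
Qed.

(** For the converse, coordinates are moved one at a time from [A i] to [x i]: the preimage of the
    closed box under a slice is closed and contains [A i]. *)
Lemma closure_box A (x : PZ) : closure (box A) x <-> forall i, closure (A i) (x i).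
Proof.
split=> [Ax i N xN|Ax].
  have xN' : nbhs x ((fun z : PZ => z i) @^-1` N) by apply: (@proj_continuous _ Z i x).
  by have [z [Az Nz]] := Ax _ xN'; exists (z i); split.
suff H : forall k (z : PZ), (forall i : 'I_n, (i < k)%N -> z i = x i) ->
    (forall i : 'I_n, (k <= i)%N -> A i (z i)) -> closure (box A) z.
  by apply: (H n) => // i; rewrite leqNgt ltn_ord.
elim=> [|k IHk] z zx zA; first by apply: subset_closure => i; exact: zA.
have [kn|nk] := ltnP k n; last first.
  apply: IHk => i ki; first by apply: zx; rewrite ltnS ltnW.
  by have := leq_trans (ltn_ord i) nk; rewrite ltnNge ki.
pose o := Ordinal kn.
have co : closed (@put z o @^-1` closure (box A)).
  by apply: closed_comp (@closed_closure _ _) => a _; exact: put_continuous.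
have Ao : A o `<=` @put z o @^-1` closure (box A).
  move=> a Aa; rewrite /preimage /put /=; apply: IHk => i ki.
    rewrite dfwith_out; first by apply: zx; rewrite ltnS ltnW.
    by rewrite -val_eqE /= gtn_eqF.
  case: dfwithP ki => // j; rewrite -val_eqE /= => kj jk; apply: zA.
  by rewrite ltn_neqAle kj jk.
have : closure (A o) (x o) by [].
move=> /(closureS Ao); rewrite -((closure_id _).1 co) /preimage /put /=.
by rewrite -(zx o) //= dfwith_id.
Qed.

(** A point of the box lets each coordinate vary separately; without one, a single empty factor
    would hide the others. *)
Lemma box_inj A B : box A !=set0 -> box A = box B -> A = B.
Proof.
move=> [x Ax] AB; have Bx : box B x by rewrite -AB.
apply: functional_extensionality_dep => i; apply/seteqP; split => a Aa.
  have : box A (dfwith x a) by move=> j; case: dfwithP.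
  by rewrite AB => /(_ i); rewrite dfwith_in.
have : box B (dfwith x a) by move=> j; case: dfwithP.
by rewrite -AB => /(_ i); rewrite dfwith_in.
Qed.

Lemma box_closure_box A B : box A !=set0 ->
  box A `<=` closure (box B) <-> forall i, A i `<=` closure (B i).
Proof.
move=> [x Ax]; split=> [AB i a Aa|AB z Az].
  have : box A (dfwith x a) by move=> j; case: dfwithP.
  by move=> /AB /closure_box /(_ i); rewrite dfwith_in.
by apply/closure_box => i; apply: AB.
Qed.

End ProductTopology.

(** * Faces and incidence signs of a product *)

Section ProductFaces.
Variables (R : realType) (n : nat) (X : 'I_n -> cornered_space R).
Let P := corner_prod X.
Let idx := forall i, {set 'I_(nhyp (X i))}.
Let sets := forall i, set (ambient (X i)).
Implicit Types (I J : idx) (t s : sets).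

Definition prod_idx J : {set 'I_(nhyp P)} :=
  [set k | tagnat.sig2 k \in J (tagnat.sig1 k)]%SET.

Definition prod_face t : set (ambient P) := box t.

Lemma in_prod_idx J i (k : 'I_(nhyp (X i))) :
  (tagnat.Rank _ k \in prod_idx J) = (k \in J i).
Proof. by rewrite inE /tagnat.sig2 /tagnat.sig1 /tagnat.Rank tagnat.rankK. Qed.

Lemma prod_idx_inj : injective prod_idx.
Proof.
move=> I J IJ; apply: functional_extensionality_dep => i; apply/setP => k.
by rewrite -!in_prod_idx IJ.
Qed.

Lemma prod_idx_surj (K : {set 'I_(nhyp P)}) : exists J, K = prod_idx J.
Proof.
exists (fun i => [set k | (tagnat.Rank _ k : 'I_(nhyp P)) \in K]%SET).
by apply/setP => k; rewrite !inE tagnat.sig2K.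
Qed.

Lemma prod_idx_subset I J : (prod_idx I \subset prod_idx J) <-> forall i, I i \subset J i.
Proof.
split=> [IJ i|IJ]; apply/fintype.subsetP => k.
  by rewrite -!in_prod_idx; apply/fintype.subsetP.
by rewrite !inE; move/(fintype.subsetP (IJ _)).
Qed.

Lemma big_prod_idx (V : nmodType) J (F : 'I_(nhyp P) -> V) :
  \sum_(k in prod_idx J) F k = \sum_i \sum_(k in J i) F (tagnat.Rank _ k).
Proof.
rewrite sig_big_dep /=.
rewrite (reindex (@tagnat.rank n (fun i => nhyp (X i)))) /=; last first.
  exact: onW_bij (@tagnat.rank_bij _ _).
by apply: eq_big => [[i k]|[i k] _] //=; rewrite -in_prod_idx.
Qed.

Lemma card_prod_idx J : #|prod_idx J| = (\sum_i #|J i|)%N.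
Proof.
rewrite -sum1_card (big_prod_idx (V := nat) _ (fun => 1%N)); apply: eq_bigr => i _.
by rewrite -sum1_card.
Qed.

Lemma carrier_prod (x : ambient P) : carrier P x <-> forall i, carrier (X i) (x i).
Proof.
split=> [xP i k|xX k]; last exact: xX.
have := xP (tagnat.Rank _ k : 'I_(nhyp P)).
by rewrite /= /tagnat.sig2 /tagnat.sig1 /tagnat.Rank tagnat.rankK.
Qed.

Lemma zeros_prod (x : ambient P) : zeros x = prod_idx (fun i => @zeros _ (X i) (x i)).
Proof. by apply/setP => k; rewrite !inE. Qed.

Lemma part_prod J : part (prod_idx J) = prod_face (fun i => part (J i)).
Proof.
apply/seteqP; split=> x; rewrite /part /prod_face /box /=.
  move=> [/carrier_prod Px]; rewrite zeros_prod => /prod_idx_inj xJ i; split => //.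
  by rewrite -xJ.
move=> xJ; split; first by apply/carrier_prod => i; case: (xJ i).
rewrite zeros_prod; congr prod_idx; apply: functional_extensionality_dep => i.
by case: (xJ i).
Qed.

(** Projections of connected sets are connected, and so are boxes with connected sides. *)
Lemma component_prod J (x : ambient P) : part (prod_idx J) x ->
  connected_component (part (prod_idx J)) x =
  prod_face (fun i => connected_component (part (J i)) (x i)).
Proof.
rewrite part_prod => xJ; apply/seteqP; split.
  move=> y [C [Cx CJ cC] Cy] i.
  exists [set z i | z in C]; last by exists y.
  split; first by exists x.
    by move=> _ [z /CJ zJ <-].
  apply: connected_continuous_connected cC _.
  by apply: continuous_subspaceT => z; apply: (@proj_continuous _ _ i z).
apply: connected_component_max.
- by move=> i; apply: connected_component_refl.
- by move=> y xy i; apply: connected_component_sub (xy i).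
- by apply: connected_box => i; apply: component_connected.
Qed.

Lemma is_face_prodP J f :
  is_face (prod_idx J) f <-> exists2 t, forall i, is_face (J i) (t i) & f = prod_face t.
Proof.
split=> [[x xJ ->]|[t tJ ->]].
  rewrite component_prod //; eexists; last by [].
  by move=> i; move: xJ; rewrite part_prod => xJ; exists (x i).
pose x : ambient P := fun i => sval (cid (is_face_neq0 (tJ i))).
have tx i : t i (x i) by rewrite /x; case: cid.
have xJ : part (prod_idx J) x.
  by rewrite part_prod => i; apply: (is_face_sub (tJ i)).
exists x => //; rewrite component_prod //; congr prod_face.
by apply: functional_extensionality_dep => i; apply: is_face_component.
Qed.

Lemma is_face_prod J t : (forall i, is_face (J i) (t i)) ->
  is_face (prod_idx J) (prod_face t).
Proof. by move=> tJ; apply/is_face_prodP; exists t. Qed.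

Lemma is_face_prod_inv J t : is_face (prod_idx J) (prod_face t) ->
  forall i, is_face (J i) (t i).
Proof.
move=> tJ; have t0 := is_face_neq0 tJ; have /is_face_prodP[s sJ /(box_inj t0) ->] := tJ.
exact: sJ.
Qed.

Hypothesis Xcont : forall i, continuous_defun (X i).
Hypothesis Xc : forall i, unique_cofaces (X i).

Lemma continuous_defun_prod : continuous_defun P.
Proof.
move=> k x; apply: (@continuous_comp _ _ _ (fun y : ambient P => y (tagnat.sig1 k))).
  exact: (@proj_continuous _ _ (tagnat.sig1 k) x).
exact: Xcont.
Qed.

(** Faces of the product are boxes, and inclusion of a nonempty box in the closure of another is
    tested coordinatewise. *)
Lemma unique_cofaces_prod : unique_cofaces P.
Proof.
move=> I' J' f; have [I ->] := prod_idx_surj I'; have [J ->] := prod_idx_surj J'.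
move=> /is_face_prodP[t tI ->] /prod_idx_subset JI.
have t0 := is_face_neq0 (is_face_prod tI).
exists (prod_face (fun i => coface (J i) (t i))); split.
  split; first by apply: is_face_prod => i; exact: (coface_is_face (@Xc i) (tI i) (JI i)).
  by apply/(box_closure_box _ t0) => i; have [] := cofaceP (@Xc i) (tI i) (JI i).
move=> _ [/is_face_prodP[s sJ ->] /(box_closure_box s t0) ts]; congr prod_face.
by apply: functional_extensionality_dep => i; apply/esym/(coface_eq (@Xc i) (tI i)).
Qed.

Lemma coface_prod I J t :
  (forall i, is_face (I i) (t i)) -> (forall i, J i \subset I i) ->
  coface (prod_idx J) (prod_face t) = prod_face (fun i => coface (J i) (t i)).
Proof.
move=> tI JI; have t0 := is_face_neq0 (is_face_prod tI).
apply/esym/(coface_eq unique_cofaces_prod (is_face_prod tI)).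
- exact/prod_idx_subset.
- by apply: is_face_prod => i; exact: (coface_is_face (@Xc i) (tI i) (JI i)).
- by apply/(box_closure_box _ t0) => i; have [] := cofaceP (@Xc i) (tI i) (JI i).
Qed.

Lemma prod_idxD1 J i (k : 'I_(nhyp (X i))) :
  prod_idx J :\ tagnat.Rank _ k = prod_idx (dfwith J (J i :\ k)).
Proof.
apply/setP => l; rewrite -(tagnat.sig2K l).
move: (tagnat.sig1 l) (tagnat.sig2 l) => j m.
rewrite in_setD1 !in_prod_idx -val_eqE tagnat.eq_Rank eq_sym.
have [ij|ij] := eqVneq i j; last by rewrite dfwith_out.
by move: m; rewrite -ij => m; rewrite dfwith_in in_setD1 val_eqE.
Qed.

Lemma coface_prodD1 J t i (k : 'I_(nhyp (X i))) :
  (forall i, is_face (J i) (t i)) -> k \in J i ->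
  coface (prod_idx J :\ tagnat.Rank _ k) (prod_face t) =
  prod_face (dfwith t (coface (J i :\ k) (t i))).
Proof.
move=> tJ kJ; rewrite prod_idxD1 (coface_prod tJ) => [|j]; last first.
  by case: dfwithP => // ; exact: subD1set.
congr prod_face; apply: functional_extensionality_dep => j.
by case: dfwithP => [|j' ij];
  [rewrite dfwith_in|rewrite dfwith_out // (coface_id (@Xc j'))].
Qed.

Lemma ltn_Rank i j (k : 'I_(nhyp (X i))) (l : 'I_(nhyp (X j))) :
  ((tagnat.Rank _ k : 'I_(nhyp P)) < (tagnat.Rank _ l : 'I_(nhyp P)))%N =
  (i < j)%N || (i == j) && (k < l)%N.
Proof.
pose tg i := @Tagged _ i (fun i => 'I_(nhyp (X i))).
have := @tagnat.lt_rank n (fun i => nhyp (X i)) (tg i k) (tg j l).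
rewrite ltEsig !ltEord !leEord /= => ->.
case: (ltngtP i j) => //= [|ij]; first by rewrite -val_eqE; case: ltngtP.
by move: l; rewrite -(val_inj ij) => l; rewrite tagged_asE eqxx.
Qed.

(** In the lexicographic order, [k] is preceded by all the indices of earlier factors, which give
    the Koszul sign, and by the smaller indices of its own factor. *)
Lemma contr_coef_prod J i (k : 'I_(nhyp (X i))) :
  @contr_coef R P (tagnat.Rank _ k) (prod_idx J) =
  (-1) ^+ (\sum_(j < n | (j < i)%N) #|J j|) * contr_coef k (J i).
Proof.
rewrite /contr_coef in_prod_idx; case: ifP => kJ; last by rewrite mulr0.
rewrite -exprD; congr (_ ^+ _).
pose L j := [set l in J j | (j < i)%N || (j == i) && (l < k)%N]%SET.
rewrite (_ : [set l in prod_idx J | _]%SET = prod_idx L); last first.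
  apply/setP => l; rewrite -(tagnat.sig2K l) finset.in_set !in_prod_idx finset.in_set.
  by rewrite ltn_Rank.
rewrite card_prod_idx (bigID (fun j : 'I_n => (j < i)%N)) /=; congr (_ + _)%N.
  by apply: eq_bigr => j ji; apply: eq_card => l; rewrite finset.in_set ji andbT.
rewrite (bigD1 i) ?ltnn //= big1 => [|j /andP[ij ji]].
  by rewrite addn0; apply: eq_card => l; rewrite !finset.in_set ltnn eqxx.
by apply: eq_card0 => l; rewrite finset.in_set (negPf ij) (negPf ji) andbF.
Qed.

Lemma face_boundary_prod J t : (forall i, is_face (J i) (t i)) ->
  face_boundary (prod_face t) = \sum_i \sum_(k in J i)
    << (-1) ^+ (\sum_(j < n | (j < i)%N) #|J j|) * contr_coef k (J i)
       *g prod_face (dfwith t (coface (J i :\ k) (t i))) >>.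
Proof.
move=> tJ; rewrite (face_boundaryE (is_face_prod tJ)) big_prod_idx.
apply: eq_bigr => i _; apply: eq_bigr => k kJ.
by rewrite contr_coef_prod coface_prodD1.
Qed.

End ProductFaces.

(** * The conormal complex of a product as a tensor product *)

Section ProductComplex.
Variables (R : realType) (n : nat) (X : 'I_n -> cornered_space R).
Hypothesis Xcont : forall i, continuous_defun (X i).
Hypothesis Xc : forall i, unique_cofaces (X i).
Let P := corner_prod X.
Let sets := forall i, set (ambient (X i)).
Let V := {freeg sets / int}.
Implicit Types (t s : sets).

Let wt i (f : set (ambient (X i))) := #|face_idx f|.

Let d i : {additive {freeg (set (ambient (X i))) / int} ->
    {freeg (set (ambient (X i))) / int}} := fglift (@face_boundary R (X i)).

Let D (x : V) : V := \sum_i coord_op wt (d i) x.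

Let D_add : {morph D : x y / x - y}.
Proof. by move=> x y; rewrite /D -sumrB; apply: eq_bigr => i _; rewrite raddfB. Qed.

HB.instance Definition _ := GRing.isZmodMorphism.Build V V D D_add.

Let D_face (J : forall i, {set 'I_(nhyp (X i))}) t : (forall i, is_face (J i) (t i)) ->
  D << t >> = \sum_i \sum_(k in J i)
    << (-1) ^+ (\sum_(j < n | (j < i)%N) #|J j|) * contr_coef k (J i)
       *g dfwith t (coface (J i :\ k) (t i)) >>.
Proof.
move=> tJ; rewrite /D; apply: eq_bigr => i _.
rewrite coord_opU /d /= fgliftU (face_boundaryE (tJ i)) raddf_sum scaler_sumr.
apply: eq_bigr => k kJ; rewrite /= /subst_coord liftU scalerA.
rewrite int_scalerE [RHS]freegUE; congr (_ *~ (_ * _)); congr (_ ^+ _).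
by apply: eq_bigr => j _; rewrite /wt (face_idxE (tJ j)).
Qed.

(** [V] contains tuples of arbitrary sets and all degrees, so [to_prod] is only a retraction onto
    the chains of degree [p]; its section [of_prod] recovers the factors of a face by projecting
    it. *)
Let to_prod p : {additive V -> chain P p} :=
  fglift (fun t => @chain_of R P p (prod_face t)).

Let of_prod p : {additive chain P p -> V} :=
  fglift (fun f : faces P p => << (fun i => [set x i | x in val f]) : sets >>).

Let chain_of_nonface p (f : set (ambient P)) : ~ faces P p f -> chain_of p f = 0.
Proof. by move=> fN; rewrite /chain_of insubN //; apply/negP => /set_mem. Qed.

Let of_prodU p J t (tP : prod_face t \in faces P p) : (forall i, is_face (J i) (t i)) ->
  of_prod p << exist (fun f => f \in faces P p) _ tP >> = << t >>.
Proof.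
move=> tJ; rewrite /of_prod /= fgliftU; congr << _ >>.
apply: functional_extensionality_dep => i /=.
have [x tx] := is_face_neq0 (is_face_prod tJ).
apply/seteqP; split=> [_ [y ty <-]|a ta]; first exact: ty.
exists (dfwith (x : forall i, ambient (X i)) a); last by rewrite dfwith_in.
by move=> j; case: dfwithP.
Qed.

Let prod_faceP p (f : faces P p) : exists J t,
  [/\ forall i, is_face (J i) (t i), (\sum_i #|J i|)%N = p & val f = prod_face t].
Proof.
have /set_mem/(facesP (continuous_defun_prod Xcont))[K Kp] := valP f.
have [J KJ] := prod_idx_surj K; rewrite KJ => /is_face_prodP[t tJ ft].
by exists J, t; split; rewrite // -card_prod_idx -KJ.
Qed.

Let prod_face_faces p J t : (forall i, is_face (J i) (t i)) -> (\sum_i #|J i|)%N = p ->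
  prod_face t \in faces P p.
Proof.
move=> tJ <-; apply/mem_set/(facesP (continuous_defun_prod Xcont)).
by exists (prod_idx J); [rewrite card_prod_idx|exact: is_face_prod].
Qed.

Let of_prodK p : cancel (of_prod p) (to_prod p).
Proof.
move=> x; apply: (@freeg_ext _ _ (to_prod p \o of_prod p) (@idfun _)) => {x} f.
have [J [t [tJ _ ft]]] := prod_faceP f.
have tP : prod_face t \in faces P p by rewrite -ft; exact: valP.
have -> : f = exist (fun f => f \in faces P p) _ tP by apply: val_inj.
rewrite [LHS]/= (of_prodU tP tJ) /to_prod /= fgliftU /chain_of.
by rewrite (insubT (fun f => f \in faces P p) tP).
Qed.

Let to_prodK p J t : (forall i, is_face (J i) (t i)) -> (\sum_i #|J i|)%N = p ->
  of_prod p (to_prod p << t >>) = << t >>.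
Proof.
move=> tJ Jp; have tP := prod_face_faces tJ Jp.
rewrite /to_prod /= fgliftU /chain_of (insubT (fun f => f \in faces P p) tP).
exact: of_prodU.
Qed.

Let chain_of_face_boundary p (K : {set 'I_(nhyp P)}) (f : set (ambient P)) :
  is_face K f -> #|K| <> p.+1 -> fglift (@chain_of R P p) (face_boundary f) = 0.
Proof.
move=> fK Kp; rewrite (face_boundaryE fK) raddf_sum big1 // => k kK /=.
rewrite liftU chain_of_nonface ?scaler0 // => /(facesP (continuous_defun_prod Xcont)).
move=> [L Lp gL]; apply: Kp; rewrite (cardsD1 k) kK -Lp -(face_idxE gL).
by rewrite (face_idxE (coface_is_face (unique_cofaces_prod Xc) fK (subD1set _ _))).
Qed.

Let to_prodD p J t : (forall i, is_face (J i) (t i)) ->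
  to_prod p (D << t >>) = fglift (@chain_of R P p) (face_boundary (prod_face t)).
Proof.
move=> tJ; rewrite (D_face tJ) (face_boundary_prod Xc tJ) !raddf_sum.
apply: eq_bigr => i _; rewrite !raddf_sum; apply: eq_bigr => k _.
by rewrite /to_prod /= !liftU.
Qed.

(** On tuples of faces of the right total codimension this compares two sums over cofaces; on all
    other tuples both sides must be shown to vanish. *)
Let delta_to_prod p x : delta P p.+1 (to_prod p.+1 x) = to_prod p (D x).
Proof.
apply: (@freeg_ext _ _ (@delta R P p.+1 \o to_prod p.+1) (to_prod p \o D)) => {x} t /=.
have Pc := continuous_defun_prod Xcont.
rewrite [X in delta _ _ X](_ : _ = chain_of p.+1 (prod_face t)); last first.
  by rewrite /to_prod /= fgliftU.
have [[J tJ]|tN] := pselect (exists J, forall i, is_face (J i) (t i)).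
  rewrite (to_prodD p tJ) /chain_of; case: insubP => [f fP fE|fN].
    rewrite /delta fgliftU deltaE ?fE //; exact: unique_cofaces_prod.
  rewrite raddf0 (chain_of_face_boundary (is_face_prod tJ)) // => Jp.
  move/negP: fN; apply; apply/mem_set/(facesP Pc).
  by exists (prod_idx J) => //; exact: is_face_prod.
(* When some [t i] is not a face, the terms of [D] on the other coordinates keep that factor and are
   killed by [to_prod], and the term on [i] vanishes with [face_boundary]. *)
have nface s i : (s i = t i) -> (~ exists J, is_face J (t i)) ->
    forall q, chain_of q (prod_face s) = 0.
  move=> si ti q; apply: chain_of_nonface => /(facesP Pc)[K _].
  have [J ->] := prod_idx_surj K => /is_face_prod_inv/(_ i); rewrite si => tJ.
  by apply: ti; exists (J i).
have [i ti] : exists i, ~ exists J, is_face J (t i).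
  apply/existsNP => tJ; apply: tN.
  by exists (fun i => sval (cid (tJ i))) => i; case: cid.
rewrite (nface t i) // raddf0 /D raddf_sum big1 // => j _ /=.
rewrite coord_opU /d /= fgliftU int_scalerE raddfMz /=.
have [ij|ij] := eqVneq i j.
  by rewrite -ij /face_boundary asboolF // raddf0 raddf0 mul0rz.
rewrite (_ : to_prod p _ = 0) ?mul0rz // /subst_coord fgliftE raddf_sum big1 // => f _.
rewrite /= int_scalerE raddfMz /= /to_prod /= fgliftU (nface _ i) ?mul0rz //.
by rewrite dfwith_out // eq_sym.
Qed.

(** Since [to_prod] is a chain map with section [of_prod], it remains to see that [D] maps a tuple
    of faces to tuples of faces of total codimension one less, on which [to_prodK] applies. *)
Let of_prodD p x : of_prod p (delta P p.+1 x) = D (of_prod p.+1 x).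
Proof.
rewrite -[in LHS](of_prodK x) delta_to_prod.
apply: (@freeg_ext _ _ (of_prod p \o (to_prod p \o (D \o of_prod p.+1)))
                       (D \o of_prod p.+1)) => {x} f /=.
have [J [t [tJ Jp ft]]] := prod_faceP f.
have tP := prod_face_faces tJ Jp.
have -> : f = exist (fun f => f \in faces P p.+1) _ tP by apply: val_inj.
rewrite (of_prodU tP tJ) (D_face tJ) !raddf_sum; apply: eq_bigr => i _.
rewrite !raddf_sum; apply: eq_bigr => k kJ.
rewrite freegUE !raddfMz /= (@to_prodK p (dfwith J (J i :\ k))) //.
  move=> j; case: (dfwithP J (J i :\ k) j) => [|j' ij].
    by rewrite dfwith_in; apply: (coface_is_face (@Xc i) (tJ i) (subD1set _ _)).
  by rewrite dfwith_out.
rewrite (bigD1 i) //= dfwith_in (eq_bigr (fun j => #|J j|)) => [|j ji]; last first.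
  by rewrite dfwith_out // eq_sym.
by apply/eq_add_S; rewrite -Jp [in RHS](bigD1 i) //= [in RHS](cardsD1 k) kJ.
Qed.

Lemma delta_prod_pure :
    (forall i, exists h : {additive {freeg (set (ambient (X i))) / int} ->
                                    {freeg (set (ambient (X i))) / int}},
      (forall f g, g \in dom (h << f >>) -> odd #|face_idx g| = ~~ odd #|face_idx f|) /\
      forall c, d i (h (d i c)) = d i c) ->
    (forall i f, d i (face_boundary f) = 0) ->
  forall p (x : chain P p.+1) (y : chain P p) m, (0 < m)%N ->
    delta P p.+1 x = y *+ m -> exists z, delta P p.+1 z = y.
Proof.
move=> dreg dd0 p x y m m0 xy.
pose h i := sval (cid (dreg i)).
have hP i := svalP (cid (dreg i)).
have [|i|i c|i|H HP] := @coord_sum_regular _ _ wt d h.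
- by move=> i f g; rewrite /d /= fgliftU; exact: dom_face_boundary.
- by have [] := hP i.
- apply: (@freeg_ext _ _ (d i \o d i) \0) => f /=.
  by rewrite fgliftU; exact: dd0.
- by have [] := hP i.
have [Y0 XY] : exists Y0, D (of_prod p.+1 x) = Y0 *+ m /\ to_prod p Y0 = y.
  by exists (of_prod p y); rewrite -of_prodD xy raddfMn of_prodK.
exists (to_prod p.+1 (H Y0)); rewrite delta_to_prod; case: XY => XY <-;
    congr (to_prod p _).
(* From [D H D = D] and [D (of_prod p.+1 x) = Y0 *+ m] follows [(D (H Y0) - Y0) *+ m = 0]; free
   groups being torsion free, [Y0] is the boundary of [H Y0]. *)
have := HP (of_prod p.+1 x); rewrite -!/(D _) XY !raddfMn /= => /eqP.
rewrite -subr_eq0 -mulrnBl => /eqP HY; apply/eqP; rewrite -subr_eq0; apply/eqP.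
apply/eqP/freeg_eqP => t.
have /(congr1 (coeff t)) := HY; rewrite coeffMn coeff0 => /eqP.
by rewrite mulrn_eq0 eqn0Ngt m0 /= => /eqP.
Qed.

End ProductComplex.

(** The solution is the fixed point of [p |-> y - g p], a contraction preserving the closed ball:
    [y - x0] and [g p] each have norm at most [r / 2]. *)
Lemma perturbation_surj (R : realType) (V : completeNormedModType R) (g : V -> V)
    (x0 y : V) (r : R) : 0 < r -> g x0 = 0 ->
    (forall p q, `|p - x0| <= r -> `|q - x0| <= r -> `|g p - g q| <= 2^-1 * `|p - q|) ->
    `|y - x0| <= r / 2 -> exists2 p, `|p - x0| <= r & p + g p = y.
Proof.
move=> r0 gx0 glip yx0.
pose U : set V := [set p | `|p - x0| <= r].
have Ux0 : U x0 by rewrite /U /= subrr normr0 ltW.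
pose T p := y - g p.
have TU : set_fun U U T.
  move=> p Up; rewrite /U /T /= addrAC (le_trans (ler_normB _ _)) //.
  rewrite [leRHS](splitr r) lerD //; have := glip p x0 Up Ux0; rewrite gx0 subr0.
  by move/le_trans; apply; rewrite mulrC ler_pM2r ?invr_gt0.
have [F TF] := Pfun TU.
have Fctr : is_contraction F.
  exists (2^-1)%:nng; split=> /=; rewrite -?TF; first by rewrite invf_lt1 // ltr1n.
  by move=> [p q] [Up Uq] /=; rewrite /T opprB addrC addrA subrK distrC; exact: glip.
have Ucl : closed U.
  rewrite (_ : U = closed_ball x0 r); first exact: closed_ball_closed.
  by rewrite closed_ballE //; apply/seteqP; split=> p; rewrite /U /= distrC.
have [p Up pE] := banach_fixed_point Fctr Ucl (ex_intro _ x0 Ux0).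
by exists p => //; move: pE; rewrite -TF /T => {1}->; rewrite subrK.
Qed.

(** * Local structure of manifolds with corners *)

Section StrictDifferentiability.
Variables (R : realType) (n : nat).
Implicit Types (f : 'rV[R]_n -> R) (x p q z : 'rV[R]_n).

Lemma derive_along f z (v : 'rV[R]_n) (s : R) : derivable f (z + s *: v) v ->
  is_derive s 1 (fun u : R => f (z + u *: v)) ('D_v f (z + s *: v)).
Proof.
have E : (fun h : R => h^-1 *: (((fun u : R => f (z + u *: v)) \o shift s) (h *: (1 :
    R^o))
              - f (z + s *: v))) =
         (fun h : R => h^-1 *: ((f \o shift (z + s *: v)) (h *: v) - f (z + s *: v))).
  apply/funext => h /=; congr (_ *: (f _ - _)).
  by rewrite scaler1 scalerDl addrCA.
by move=> fd; split; rewrite /derivable /derive E.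
Qed.

Lemma mean_value_along f z (v : 'rV[R]_n) (h a e : R) : 0 <= h ->
  (forall s, 0 <= s <= h ->
    derivable f (z + s *: v) v /\ `|'D_v f (z + s *: v) - a| <= e) ->
  `|f (z + h *: v) - f z - h * a| <= e * h.
Proof.
move=> h0 fv; pose phi u : R := f (z + u *: v).
have dphi s : 0 <= s <= h -> is_derive s 1 phi ('D_v f (z + s *: v)).
  by move=> /fv[fs _]; exact: derive_along.
have [s|s|c cin E] := @MVT_segment R phi (fun s => 'D_v f (z + s *: v)) 0 h h0.
- by rewrite in_itv /= => /andP[s0 sh]; apply: dphi; rewrite !ltW.
- apply: (@continuous_in_subspaceT _ _ `[0, h]%classic phi) s => s.
  rewrite inE /= in_itv /= => sh; have ds := dphi s sh.
  by apply: differentiable_continuous; apply/derivable1_diffP.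
move: cin; rewrite in_itv /= => ch; have [_ ca] := fv c ch.
move: E; rewrite /phi scale0r addr0 subr0 => ->.
by rewrite [h * a]mulrC -mulrBl normrM (ger0_norm h0) ler_wpM2r.
Qed.

(** Go from [p] to [q] along the axes, one coordinate at a time, and use the mean value theorem on
    each edge. *)
Lemma coordinate_increment f x (r e : R) (a : 'I_n -> R) :
  (forall y i, ball x r y ->
     derivable f y (delta_mx 0 i) /\ `|'D_(delta_mx 0 i) f y - a i| <= e) ->
  forall p q, ball x r p -> ball x r q ->
  `|f q - f p - \sum_i (q - p) 0 i * a i| <= e * \sum_i `|(q - p) 0 i|.
Proof.
move=> fa p q pr qr.
have [r0 _] := pr.
pose z k := \row_(i < n) (if (i < k)%N then q 0 i else p 0 i).
have step (k : 'I_n) : z k.+1 = z k + (q 0 k - p 0 k) *: delta_mx 0 k.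
  apply/rowP => i; rewrite !mxE eqxx /= ltnS leq_eqVlt.
  have [->|ik] := eqVneq i k; first by rewrite eqxx ltnn mulr1 subrKC.
  by rewrite mulr0 addr0; move: ik; rewrite -val_eqE /= => /negPf ->.
(* Balls of the sup norm are boxes, so they contain these edges. *)
have zball (k : 'I_n) s : (p 0 k <= s <= q 0 k) || (q 0 k <= s <= p 0 k) ->
    ball x r (z k + (s - p 0 k) *: delta_mx 0 k).
  move=> ks; split=> // i j; rewrite [i]ord1 !mxE eqxx /=.
  have [_ /(_ 0 j) pj] := pr; have [_ /(_ 0 j) qj] := qr.
  move: pj qj; have [->|jk] := eqVneq j k => pj qj; last by rewrite mulr0 addr0;
      case: ifP.
  rewrite ltnn mulr1 subrKC.
  move: pj qj; rewrite -!ball_normE /= !ltr_distlC => pj qj.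
  by move/orP: ks => [] /andP[] ? ?; move/andP: pj => [? ?]; move/andP: qj => [? ?];
    apply/andP; split; lra.
have incr (k : 'I_n) :
    `|f (z k.+1) - f (z k) - (q 0 k - p 0 k) * a k| <= e * `|q 0 k - p 0 k|.
  have [h0|h0] := lerP 0 (q 0 k - p 0 k).
    rewrite (ger0_norm h0) step; apply: mean_value_along => // s /andP[s0 sh].
    apply: fa; rewrite -[s](addrK (p 0 k)).
    by apply: zball; apply/orP; left; rewrite lerDr s0 -lerBrDr.
  (* A decreasing coordinate is travelled backwards, from [z k.+1] to [z k]. *)
  rewrite (ltr0_norm h0) opprB.
  have zE : z k = z k.+1 + (p 0 k - q 0 k) *: delta_mx 0 k.
    by rewrite step -addrA -scalerDl -[p 0 k - q 0 k]opprB subrr scale0r addr0.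
  have -> : `|f (z k.+1) - f (z k) - (q 0 k - p 0 k) * a k| =
     `|f (z k.+1 + (p 0 k - q 0 k) *: delta_mx 0 k) - f (z k.+1) - (p 0 k - q 0 k) * a k|.
    by rewrite -zE -normrN; congr (`| _ |); ring.
  have pq0 : 0 <= p 0 k - q 0 k by lra.
  apply: mean_value_along => // s /andP[s0 sh]; apply: fa.
  rewrite step -addrA -scalerDl (_ : _ + s = (q 0 k + s) - p 0 k); last by ring.
  by apply: zball; apply/orP; right; lra.
have qE : z n = q by apply/rowP => i; rewrite mxE ltn_ord.
have pE : z 0%N = p by apply/rowP => i; rewrite mxE.
have -> : f q - f p = \sum_(i < n) (f (z i.+1) - f (z i)).
  by rewrite -(big_mkord xpredT (fun i => f (z i.+1) - f (z i))) telescope_sumr // qE pE.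
rewrite -sumrB mulr_sumr; apply: le_trans (ler_norm_sum _ _ _) _.
by apply: ler_sum => i _; rewrite !mxE; exact: incr.
Qed.

End StrictDifferentiability.

HB.instance Definition _ (R : realType) (n : nat) := NormedModule.on 'rV[R]_n.

Lemma row_norm_coord (R : realType) (n : nat) (x : 'rV[R]_n) i : `|x 0 i| <= `|x|.
Proof.
rewrite [leRHS]/Num.norm /= mx_normrE.
exact: (@le_bigmax _ _ _ 0 (fun ij : 'I_1 * 'I_n => `|x ij.1 ij.2|) (0, i)).
Qed.

Lemma row_norm_le (R : realType) (n : nat) (x : 'rV[R]_n) (c : R) : 0 <= c ->
  (forall i, `|x 0 i| <= c) -> `|x| <= c.
Proof.
move=> c0 xc; rewrite [leLHS]/Num.norm /= mx_normrE.
by apply: bigmax_le => // -[i j] _ /=; rewrite [i]ord1.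
Qed.

(** Strict differentiability: continuous partial derivatives stay within [e] of their values at [x]
    on small balls. *)
Lemma Ck1_strict_diff (R : realType) (n : nat) (U : set 'rV[R]_n) (f : 'rV[R]_n -> R)
    (x : 'rV[R]_n) (e : R) : open U -> Ck_on 1 U f -> U x -> 0 < e ->
  \forall r \near 0^'+, forall p q, ball x r p -> ball x r q ->
    `|f q - f p - \sum_i (q - p) 0 i * 'D_(delta_mx 0 i) f x| <=
      e * \sum_i `|(q - p) 0 i|.
Proof.
move=> Uo [_ fC1] Ux e0.
have : \forall y \near x, forall i : 'I_n, derivable f y (delta_mx 0 i) /\
    `|'D_(delta_mx 0 i) f y - 'D_(delta_mx 0 i) f x| <= e.
  apply: (@filter_forall _ _ (fun i y => derivable f y (delta_mx 0 i) /\
    `|'D_(delta_mx 0 i) f y - 'D_(delta_mx 0 i) f x| <= e) _ (nbhs_filter x)) => i.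
  have [fd [fc _]] := fC1 i.
  have yU : \forall y \near x, U y by exact: open_nbhs_nbhs.
  have /cvgrPdist_le /(_ e e0) ye := fc x Ux.
  near=> y; split; first by apply: fd; near: y.
  by rewrite distrC; near: y.
move=> /nbhs_ballP[r0 /= r00 xr0].
near=> r => p q; apply: coordinate_increment => y i yr.
apply: (xr0 y) => //; apply: le_ball yr.
by near: r; exact: nbhs_right_le.
Unshelve. all: by end_near. Qed.

Lemma convex_connected (R : realType) (V : normedModType R) (C : set V) :
  (forall a b t, C a -> C b -> 0 <= t <= 1 -> C (a + t *: (b - a))) -> connected C.
Proof.
move=> cvx; have [->|/set0P[c Cc]] := eqVneq C set0; first exact: connected0.
pose seg b := (fun t : R => c + t *: (b - c)) @` `[0, 1]%classic.
have -> : C = \bigcup_(b in C) seg b.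
  apply/seteqP; split=> [b Cb|_ [b Cb [t + <-]]].
    by exists b => //; exists 1; rewrite /= ?in_itv /= ?ler01 ?lexx // scale1r subrKC.
  by rewrite /= in_itv /= => t01; exact: cvx.
apply: bigcup_connected.
  by exists c => b Cb; exists 0; rewrite /= ?in_itv /= ?ler01 ?lexx // scale0r addr0.
move=> b Cb; apply: connected_continuous_connected; first exact: segment_connected.
apply: continuous_subspaceT => t; apply: cvgD; first exact: cvg_cst.
exact: (@scalel_continuous _ _ (b - c) t).
Qed.

Lemma convex_gt0 (R : realFieldType) (t u v : R) : 0 <= t <= 1 -> 0 < u -> 0 < v ->
  0 < (1 - t) * u + t * v.
Proof.
move=> /andP[t0 t1] u0 v0; have [->|tn1] := eqVneq t 1;
    first by rewrite subrr mul0r add0r mul1r.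
by rewrite ltr_pwDl ?mulr_ge0 ?(ltW v0) // mulr_gt0 // subr_gt0 lt_neqAle tn1.
Qed.

(** * Simultaneous straightening of independent functions *)

Section Straightening.
Variables (R : realType) (n m : nat) (U : set 'rV[R]_n) (f : 'I_m -> 'rV[R]_n -> R).
Variable x0 : 'rV[R]_n.
Hypothesis Uo : open U.
Hypothesis fC1 : forall k, Ck_on 1 U (f k).
Hypothesis Ux0 : U x0.
Let A := \matrix_(k < m, i < n) 'D_(delta_mx 0 i) (f k) x0.
Hypothesis fA : row_free A.

(** [A] has full row rank, so its pseudo-inverse is a right inverse; [E] is the remainder of the
    [f k] after their linear parts at [x0]. *)
Let B : 'M[R]_(n, m) := pinvmx A.
Let E p : 'rV[R]_m := \row_k f k p - (p - x0) *m A^T.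
Let g p : 'rV[R]_n := E p *m B^T.

Let AB1 : B^T *m A^T = 1%:M.
Proof. by rewrite -trmx_mul mulmxVp // trmx1. Qed.

Let g_value p : (p + g p - x0) *m A^T = \row_k f k p.
Proof. by rewrite addrAC mulmxDl -mulmxA AB1 mulmx1 /E subrKC. Qed.

(* The map [p |-> p + g p] straightens the [f k]: it sends them to the coordinates
   along the dual basis [B] of their differentials, while [g] has derivative zero
   at [x0]. *)
Let g_lipschitz : \forall r \near 0^'+, forall p q, ball x0 r p -> ball x0 r q ->
  `|g p - g q| <= 2^-1 * `|p - q|.
Proof.
pose S := \sum_i \sum_k `|B i k|.
have S0 : 0 <= S by apply: sumr_ge0 => i _; apply: sumr_ge0.
have nS0 : 0 <= n%:R * S by rewrite mulr_ge0.
(* [n%:R] bounds the sum of the coordinates by the sup norm and [S] accounts for [B]; this choice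
   gives [e * (n%:R * S) <= 1 / 2], the added 1 keeping the denominator positive. *)
pose e := (2 * (n%:R * S + 1))^-1.
have e0 : 0 < e by rewrite invr_gt0 mulr_gt0 // ltr_wpDl.
have : \forall r \near 0^'+, forall k p q, ball x0 r p -> ball x0 r q ->
    `|f k q - f k p - \sum_i (q - p) 0 i * 'D_(delta_mx 0 i) (f k) x0| <=
    e * \sum_i `|(q - p) 0 i|.
  apply: (@filter_forall _ _ _ _ (at_right_proper_filter 0)) => k.
  exact: Ck1_strict_diff (fC1 k) Ux0 e0.
apply: filterS => r fr p q pr qr.
have Epq k : `|(E p - E q) 0 k| <= e * (n%:R * `|p - q|).
  rewrite (_ : (E p - E q) 0 k =
    f k p - f k q - \sum_i (p - q) 0 i * 'D_(delta_mx 0 i) (f k) x0); last first.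
    have -> : E p - E q = \row_k f k p - \row_k f k q - (p - q) *m A^T.
      rewrite (_ : p - q = (p - x0) - (q - x0)); last by rewrite opprB addrA subrK.
      by rewrite mulmxBl /E !opprB [X in _ + X = _]addrC addrACA [X in _ + X = _]addrC.
    by rewrite !mxE; congr (_ - _); apply: eq_bigr => i _; rewrite !mxE.
  apply: le_trans (fr k q p qr pr) _; rewrite ler_wpM2l ?(ltW e0) //.
  rewrite mulr_natl -[X in _ *+ X]card_ord -sumr_const.
  by apply: ler_sum => i _; exact: row_norm_coord.
rewrite /g -mulmxBl; apply: row_norm_le => [|i]; first by rewrite mulr_ge0 ?invr_ge0.
rewrite mxE; apply: le_trans (ler_norm_sum _ _ _) _.
apply: (@le_trans _ _ (\sum_k e * (n%:R * `|p - q|) * `|B i k|)).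
  by apply: ler_sum => k _; rewrite normrM [B^T _ _]mxE ler_wpM2r.
rewrite -mulr_sumr.
apply: (@le_trans _ _ (e * (n%:R * `|p - q|) * S)).
  rewrite ler_wpM2l ?mulr_ge0 ?(ltW e0) // /S [leRHS](bigD1 i) //= lerDl.
  by apply: sumr_ge0 => j _; apply: sumr_ge0.
rewrite (_ : _ * S = (e * (n%:R * S)) * `|p - q|); last by ring.
rewrite ler_wpM2r // /e invfM -mulrA ler_piMr ?invr_ge0 //.
by rewrite mulrC ler_pdivrMr ?mul1r ?lerDl // ltr_wpDl.
Qed.

Hypothesis fx0 : forall k, f k x0 = 0.

(** [G = id + g] has a Lipschitz inverse [K] over a small ball, and turns the [f k] into linear
    forms. The strata in [N] are images under [K] of convex sets, cut out of that ball by linear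
    equations and inequalities. *)
Lemma straighten (W : set 'rV[R]_n) : nbhs x0 W ->
  exists N, [/\ nbhs x0 N, N `<=` W & forall J : {set 'I_m},
    connected (N `&` [set y | forall k, if k \in J then f k y = 0 else 0 < f k y]) /\
    N `&` [set y | forall k, if k \in J then f k y = 0 else 0 < f k y] !=set0].
Proof.
move=> /nbhs_ballP[r1 /= r10 r1W].
have gx0 : g x0 = 0.
  rewrite /g /E subrr mul0mx subr0 (_ : \row_k _ = 0) ?mul0mx //.
  by apply/rowP => k; rewrite !mxE fx0.
have [r [r0 rr1 glip]] : exists r : R, [/\ 0 < r, r < r1 & forall p q,
    `|p - x0| <= r -> `|q - x0| <= r -> `|g p - g q| <= 2^-1 * `|p - q|].
  have [r [r0 rr1 gr]] : exists r : R, [/\ 0 < r, r < r1 & forall p q,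
      ball x0 r p -> ball x0 r q -> `|g p - g q| <= 2^-1 * `|p - q|].
    near (0 : R)^'+ => r; exists r; split; near: r.
    - exact: nbhs_right_gt.
    - exact: nbhs_right_lt.
    - exact: g_lipschitz.
  (* Halving the radius passes from open to closed balls. *)
  have r20 : r / 2 < r by rewrite ltr_pdivrMr // ltr_pMr // ltr1n.
  exists (r / 2); split; [by rewrite divr_gt0|exact: lt_trans rr1|].
  by move=> p q pr qr; apply: gr; rewrite -ball_normE /= distrC (le_lt_trans _ r20).
pose G p := p + g p.
have GP p k : ((G p - x0) *m A^T) 0 k = f k p by rewrite /G g_value mxE.
have G_inj p q : `|p - x0| <= r -> `|q - x0| <= r -> `|p - q| <= 2 * `|G p - G q|.
  move=> pr qr; have := glip p q pr qr.
  have : `|p - q| <= `|G p - G q| + `|g p - g q|.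
    rewrite (_ : p - q = (G p - G q) - (g p - g q)); first exact: ler_normB.
    by rewrite /G opprD addrACA [X in _ = X]addrK.
  by lra.
(* The second condition makes [G] map [N] onto the whole ball of radius [r / 2], which is convex. *)
pose N := [set p | `|p - x0| <= r /\ `|G p - x0| < r / 2].
have [K KP] : exists K : 'rV[R]_n -> 'rV[R]_n, forall y, `|y - x0| < r / 2 ->
    `|K y - x0| <= r /\ G (K y) = y.
  have Kex y : exists p, `|y - x0| < r / 2 -> `|p - x0| <= r /\ G p = y.
    have [yr|yr] := pselect (`|y - x0| < r / 2); last by exists x0.
    have [p pr Gp] := perturbation_surj r0 gx0 glip (ltW yr).
    by exists p.
  by exists (fun y => sval (cid (Kex y))) => y; exact: svalP (cid (Kex y)).
exists N; split.
(* As [|g p| <= |p - x0| / 2], the distance from [G p] to [x0] is below [3 r / 8]. *)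
- apply/nbhs_ballP; exists (r / 4) => /=; first by rewrite divr_gt0.
  move=> p; rewrite -ball_normE /= distrC => pr.
  have pr' : `|p - x0| <= r by lra.
  have := glip p x0 pr'; rewrite subrr normr0 gx0 subr0 => /(_ (ltW r0)) gp.
  split => //; rewrite /G addrAC; apply: le_lt_trans (ler_normD _ _) _; lra.
- by move=> p [pr _]; apply: r1W; rewrite -ball_normE /= distrC (le_lt_trans pr).
- move=> J; set C := (X in connected X); rewrite -/C.
  pose C' := [set y | `|y - x0| < r / 2 /\ forall k,
    let v := ((y - x0) *m A^T) 0 k in if k \in J then v = 0 else 0 < v].
  have CE : C = K @` C'.
    apply/seteqP; split=> [p [[pr Gp] pJ]|_ [y [yr yJ] <-]].
      have [Kp KG] := KP _ Gp.
      exists (G p); first by split => // k /=; rewrite GP; exact: pJ.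
      by apply/subr0_eq/normr0_eq0/le_anti; rewrite normr_ge0 andbT
        (le_trans (G_inj _ _ Kp pr)) // KG subrr normr0 mulr0.
    have [Kr KG] := KP y yr; split; first by split; rewrite ?KG.
    by move=> k; move: (yJ k) => /=; rewrite -GP KG.
  split; rewrite CE.
    apply: connected_continuous_connected.
      apply: convex_connected => a b t [ar aJ] [br bJ] /andP[t0 t1].
      have cE : a + t *: (b - a) - x0 = (1 - t) *: (a - x0) + t *: (b - x0).
        by apply/rowP => i; rewrite !mxE; ring.
      split; first apply: le_lt_trans (_ : (1 - t) * `|a - x0| + t * `|b - x0| < _).
      - rewrite cE; apply: le_trans (ler_normD _ _) _.
        by rewrite !normrZ !ger0_norm ?subr_ge0.
      - rewrite -subr_gt0 (_ : _ - _ =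
          (1 - t) * (r / 2 - `|a - x0|) + t * (r / 2 - `|b - x0|)); last by ring.
        by apply: convex_gt0 => //; rewrite ?subr_gt0 // t0.
      - move=> k /=; rewrite cE mulmxDl -!scalemxAl 2!mxE [X in _ + X]mxE.
        move: (aJ k) (bJ k) => /=; case: ifP => _ va vb.
          by rewrite va vb !mulr0 addr0.
        by apply: convex_gt0 => //; rewrite t0.
    apply/subspace_continuousP => y [yr _].
    apply/cvgrPdist_le => e e0; near=> z.
    have [zr _] : C' z by near: z; exact: withinT.
    have [[Ky KGy] [Kz KGz]] := (KP y yr, KP z zr).
    apply: le_trans (G_inj _ _ Ky Kz) _; rewrite KGy KGz mulrC -ler_pdivlMr //.
    near: z; apply: cvg_within; have /cvgrPdist_le := @cvg_id _ (nbhs y); apply.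
    by rewrite divr_gt0.
  (* By duality the linear forms take on [w] the value 0 on [J] and 1 elsewhere; the factor [t]
     brings [w] into the ball. *)
  pose w : 'rV[R]_n := (\row_k (k \notin J)%:R) *m B^T.
  pose t := r / 4 / (1 + `|w|).
  have w0 : 0 < 1 + `|w| by rewrite ltr_pwDl.
  have t0 : 0 < t by rewrite !divr_gt0.
  exists (K (x0 + t *: w)), (x0 + t *: w) => //; split; rewrite addrAC subrr add0r.
    rewrite normrZ gtr0_norm // /t (_ : _ * `|w| = r / 4 * (`|w| / (1 + `|w|)));
        last first.
      by rewrite -!mulrA [`|w| * _]mulrC.
    apply: (@lt_trans _ _ (r / 4)); last by lra.
    by rewrite gtr_pMr ?divr_gt0 // ltr_pdivrMr // mul1r ltrDr.
  move=> k /=; rewrite -scalemxAl /w -mulmxA AB1 mulmx1 !mxE.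
  by case: (k \in J); rewrite ?mulr0 ?mulr1.
Unshelve. all: by end_near. Qed.

End Straightening.

Section ManifoldWithCorners.
Variables (R : realType) (M : manifold_with_corners R).
Implicit Types (x y : ambient M).
Let S := mwc_smooth M.

Section Chart.
Variables (c : chart R (ambient M) (mwc_dim M)).
Hypothesis cS : atlas S c.

Lemma chart_map_continuous_at x : chart_dom c x -> {for x, continuous (chart_map c)}.
Proof.
move=> cx; have := @chart_map_cont _ _ _ c; rewrite continuous_open_subspace;
    last exact: chart_dom_open.
by apply; rewrite inE.
Qed.

Lemma chart_inv_continuous_at x : chart_dom c x ->
  {for chart_map c x, continuous (chart_inv c)}.
Proof.
move=> cx; have := @chart_inv_cont _ _ _ c; rewrite continuous_open_subspace;
    last exact: chart_img_open.
by apply; rewrite inE; exists x.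
Qed.

Lemma defun_Ck j k : Ck_on k (chart_map c @` chart_dom c) (@defun R M j \o chart_inv c).
Proof. exact: mwc_defun_smooth cS k. Qed.

Lemma defun_continuous_at j x : chart_dom c x -> {for x, continuous (@defun R M j)}.
Proof.
move=> cx; have [fc _] := defun_Ck j 0.
have fcx : {for chart_map c x, continuous (@defun R M j \o chart_inv c)}.
  by apply: fc; exists x.
have H := continuous_comp (chart_map_continuous_at cx) fcx.
have E : {near x, (@defun R M j \o chart_inv c) \o chart_map c =1 @defun R M j}.
  have : nbhs x (chart_dom c) by apply: open_nbhs_nbhs; split => //;
      exact: chart_dom_open.
  by apply: filterS => y cy /=; rewrite chart_mapK.
have -> : {for x, continuous (@defun R M j)} =
    (@defun R M j y @[y --> x] --> (@defun R M j \o chart_inv c) (chart_map c x)).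
  by rewrite /= chart_mapK.
exact: cvg_trans (near_eq_cvg E) H.
Qed.

Lemma dcoord_row_free x : chart_dom c x ->
  row_free (\matrix_(k < #|zeros x|, i < mwc_dim M)
    'D_(delta_mx 0 i) (@defun R M (enum_val k) \o chart_inv c) (chart_map c x)).
Proof.
move=> cx; have := @mwc_independent R M (zeros x) x _ c cS cx.
set A := \matrix_(k, i) _; set X := [seq _ | j <- _] => Xfree.
have sX : size X == #|zeros x| by rewrite size_map cardE.
have /(@freeP _ _ _ (Tuple sX)) Xf : free X.
  by apply: Xfree => j; rewrite inE => /eqP.
apply: inj_row_free => v vA; apply/rowP => k; rewrite mxE.
apply: (Xf (fun k => v 0 k)); rewrite -[RHS]vA mulmx_sum_row; apply: eq_bigr => l _.
congr (_ *: _); rewrite (nth_map (enum_val l)) -?cardE //; apply/rowP => i.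
by rewrite !mxE -enum_val_nth.
Qed.

End Chart.

Lemma mwc_continuous_defun : continuous_defun M.
Proof.
move=> j x; have [c cS cx] := atlas_cover S x.
exact: defun_continuous_at cx.
Qed.

(** In a chart the functions vanishing at [x] have independent differentials, so [straighten]
    applies to them. *)
Lemma mwc_locally_conical : locally_conical M.
Proof.
move=> x Mx J Jx W xW; have [c cS cx] := atlas_cover S x.
pose I := zeros x; pose U := chart_map c @` chart_dom c.
have Uo : open U by exact: chart_img_open.
have Ux : U (chart_map c x) by exists x.
pose f (k : 'I_#|I|) := @defun R M (enum_val k) \o chart_inv c.
have fx0 k : f k (chart_map c x) = 0.
  rewrite /f /= chart_mapK //; apply/eqP; have := enum_valP k.
  by rewrite inE.
(* On [W1] the functions nonzero at [x] stay positive, so that those indexed by [I] alone decide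
   membership in [part J]. *)
pose W1 := W `&` [set y | forall j, j \notin I -> 0 < @defun R M j y].
have xW1 : nbhs x W1.
  apply: filterI => //.
  apply: (@filter_forall _ _ (fun j y => j \notin I -> 0 < @defun R M j y) _
      (nbhs_filter x)).
  move=> j; have [jI|jI] := boolP (j \in I); first by apply: nearW.
  have jx : 0 < @defun R M j x by rewrite lt_neqAle Mx eq_sym andbT; rewrite inE in jI.
  by apply: (filterS _ (cvgr_gt _ (@mwc_continuous_defun j x) _ jx)) => y jy _.
have W2 : nbhs (chart_map c x) (U `&` chart_inv c @^-1` W1).
  apply: filterI; first by apply: open_nbhs_nbhs; split.
  by have := chart_inv_continuous_at cx; apply; rewrite /= chart_mapK.
have [N [xN NW NJ]] := straighten Uo (fun k => defun_Ck cS (enum_val k) 1) Ux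
  (dcoord_row_free cS cx) fx0 W2.
exists (chart_inv c @` N).
have NJ' : part J `&` chart_inv c @` N = chart_inv c @`
    (N `&` [set y | forall k, if k \in [set k | enum_val k \in J]%SET
      then f k y = 0 else 0 < f k y]).
  apply/seteqP; split=> [y [[My yJ] [v Nv vy]]|_ [v [Nv vJ] <-]].
    exists v => //; split => // k; rewrite inE -yJ inE /f /= vy.
    have := My (enum_val k); case: ifP => [/eqP //|+ k0].
    by rewrite lt_neqAle k0 eq_sym andbT => /negbT.
  have [_ [_ vI]] := NW v Nv.
  have vE j : j \in I -> if j \in J then @defun R M j (chart_inv c v) = 0
                         else 0 < @defun R M j (chart_inv c v).
    move=> jI; have := vJ (enum_rank_in jI j).
    by rewrite /f /= inE enum_rankK_in.
  split; last by exists v.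
  split=> [j|].
    have [/vE|/vI /ltW //] := boolP (j \in I).
    by case: ifP => [_ ->|_ /ltW].
  apply/setP => j; rewrite inE; have [/vE|jI] := boolP (j \in I).
    by case: ifP => [_ ->|_ /gt_eqF]; rewrite ?eqxx.
  rewrite gt_eqF ?vI //; apply/esym/negbTE.
  by apply: contra jI; apply/fintype.subsetP.
have [Nc N0] := NJ [set k | enum_val k \in J]%SET.
split.
- have : nbhs x (chart_dom c `&` chart_map c @^-1` N).
    apply: filterI; first by apply: open_nbhs_nbhs; split => //; exact: chart_dom_open.
    exact: chart_map_continuous_at.
  by apply: filterS => y [cy Ny]; exists (chart_map c y) => //; rewrite chart_mapK.
- by move=> _ [v /NW[_ []] + _ <-].
- rewrite NJ'; apply: connected_continuous_connected => //.
  apply: continuous_subspaceW (@chart_inv_cont _ _ _ c) => v [/NW[]] //.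
- by rewrite NJ'; have [v Nv] := N0; exists (chart_inv c v), v.
Qed.

End ManifoldWithCorners.

(** * Purity of boundaries and torsion *)

Local Open Scope quotient_scope.

(** A class killed by [m] is that of a cycle [y] with [y *+ m] a boundary; purity makes [y] a
    boundary too. *)
Lemma torsion_free_homology (C2 C1 C0 : zmodType) (d' : {additive C2 -> C1})
    (d : {additive C1 -> C0}) :
    (forall x y m, (0 < m)%N -> d' x = y *+ m -> exists z, d' z = y) ->
  torsion_free (homology d' d).
Proof.
move=> pure q m m0; elim/quotW: q => y.
pose pi : {additive cycles d -> homology d' d} := \pi_(Quotient.quot (bdry d' (d := d))).
have pi0 z : (pi z == 0) = (z \in bdry d' (d := d)).
  by rewrite -(raddf0 pi) /= -Quotient.idealrBE subr0.
move=> /eqP; rewrite -[\pi y]/(pi y) -raddfMn pi0 => /asboolP[x].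
rewrite raddfMn => /(pure _ _ _ m0)[z zy].
by apply/eqP; rewrite pi0; apply/asboolP; exists z.
Qed.

Lemma torsion_free_dsum (M : nat -> zmodType) :
  (forall p, torsion_free (M p)) -> torsion_free (dsum M).
Proof.
move=> Mtf s m m0 sm; apply: dsum_eqP => p; apply: (Mtf p _ m m0).
have sE k : (s *+ k) p = s p *+ k by elim: k => [//|k IHk]; rewrite !mulrS /= IHk.
by rewrite -sE sm.
Qed.

Theorem corollary4p9 (R : realType) (n : nat)
    (X : 'I_n -> manifold_with_corners R)
    (X_connected : forall i : 'I_n, connected (carrier (X i)))
    (X_codim : forall i : 'I_n, (codim (X i) <= 2)%N) :
  torsion_free (H0pcn (corner_prod (fun i : 'I_n => mwc_space (X i)))) /\
  torsion_free (H1pcn (corner_prod (fun i : 'I_n => mwc_space (X i)))).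
Proof.
have Xcont i := @mwc_continuous_defun R (X i).
have Xc i := locally_conical_unique_cofaces (@mwc_locally_conical R (X i)).
have tf p : torsion_free (Hcn (corner_prod (fun i : 'I_n => mwc_space (X i))) p).
  (* Torsion in degree [p] is governed by the image of [delta] from degree [p.+1], which the
     generalized inverses of the factors make pure. *)
  apply: torsion_free_homology => x y m; apply: (delta_prod_pure Xcont Xc).
    by move=> i; apply: face_boundary_regular.
  by move=> i f; apply: face_boundary_square.
by split; apply: torsion_free_dsum => p; exact: tf.
Qed.
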